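(* Given $\theta\in\mathbb{R}$, $(x_0,u_0)\in X$ and $d\in L^\infty(\mathbb{R}_+)$, there exist $t_{\max}\in(0,+\infty]$ and a unique pair of continuous mappings $x,u:[-r,t_{\max})\to\mathbb{R}$ with $x\in W^{1,\infty}((-r,T))$ for all $T<t_{\max}$, $x(s)=x_0(s)$ and $u(s)=u_0(s)$ for all $s\in[-r,0]$, such that $$\dot x(t)=\theta x(t)+u(t)+d(t)\quad\text{for almost every } t\in[0,t_{\max}),$$ $$u(t)=-\left(2c+p(x_t,u_t)\right)x(t)\quad\text{for all } t\in[0,t_{\max}).$$ Moreover, if $t_{\max}<+\infty$ then $\limsup_{t\to t_{\max}^-}|u(t)|=+\infty$.
   Context: $\varepsilon,c,r>0$ are fixed constants and $\mathbb{R}_+=[0,+\infty)$. For $a\in\mathbb{R}$, $(a)^+=\max(a,0)$. For a function $v$ defined on an interval containing $[t-r,t]$, $v_t$ denotes the history $v_t(s)=v(t+s)$, $s\in[-r,0]$. For functions on $[-r,0]$: $\langle f,g\rangle=\int_{-r}^0 f(s)g(s)\,ds$ and $\|f\|_2=\left(\int_{-r}^0 f^2(s)\,ds\right)^{1/2}$. For an interval $I$, $W^{1,\infty}(I)$ is the set of absolutely continuous functions $f:I\to\mathbb{R}$ with $f,f'\in L^\infty(I)$ (identified with their continuous extensions to finite endpoints of $I$). The functional $p$ is $$p(x,u)=\frac{\left(x^2(0)-x^2(-r)-2\langle x,u\rangle\right)^+ + c\,r\,x^2(0)}{2\left(\|x\|_2^2+\left(\varepsilon^2-x^2(0)\right)^+\right)},\qquad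 (x,u)\in C^0([-r,0];\mathbb{R}^2),$$ and $$X=\left\{(x,u)\in W^{1,\infty}((-r,0))\times C^0([-r,0]) : u(0)=-(p(x,u)+2c)\,x(0)\right\}.$$ *)

(* Defs.v *)
From HB Require Import structures.
From mathcomp Require Export all_boot all_order all_algebra.
From mathcomp Require Export all_classical all_reals all_analysis.
Export Order.TTheory GRing.Theory Num.Theory.
Export numFieldNormedType.Exports.

Set Implicit Arguments.
Unset Strict Implicit.
Unset Printing Implicit Defensive.

Local Open Scope classical_set_scope.
Local Open Scope ring_scope.

(** Functions on an interval are represented by total functions [R -> R]; only
    their values on the interval matter in the definitions below. *)

Section FunctionSpaces.
Context {R : realType}.
Implicit Types (I : set R) (f : R -> R).

(** [Lfun] asks for Borel measurability on the whole line. Members of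
    L^oo(I) are classes of Lebesgue measurable functions modulo null sets, and
    each class has a Borel representative on [R] (extend by 0). *)
Definition Linfty I f : Prop :=
  exists2 g : R -> R, g \in Lfun (@lebesgue_measure R) +oo%E &
    {ae @lebesgue_measure R, forall t, I t -> f t = g t}.

Definition abs_cont I f : Prop :=
  forall e : R, 0 < e -> exists2 delta : R, 0 < delta &
    forall (n : nat) (a b : 'I_n -> R),
      (forall i, [/\ I (a i), I (b i) & a i <= b i]) ->
      trivIset setT (fun i => `]a i, b i[%classic) ->
      \sum_(i < n) (b i - a i) < delta ->
      \sum_(i < n) `|f (b i) - f (a i)| < e.

(** W^{1,oo}((a, b)), a function being identified with its continuous extension
    to [[a, b]]. An absolutely continuous function is differentiable almost
    everywhere, and [Linfty] ignores the junk values of [derive1 f] elsewhere. *)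
Definition W1infty (a b : R) f : Prop :=
  [/\ {within `[a, b], continuous f},
      abs_cont `]a, b[%classic f,
      Linfty `]a, b[%classic f
    & Linfty `]a, b[%classic (derive1 f)].

End FunctionSpaces.

Section Feedback.
Context {R : realType}.
Implicit Types (eps c r theta : R) (x u d f g : R -> R).

Definition inner r f g : R :=
  \int[@lebesgue_measure R]_(s in `[- r, 0]) (f s * g s).

Definition norm2 r f : R :=
  Num.sqrt (\int[@lebesgue_measure R]_(s in `[- r, 0]) (f s ^+ 2)).

Definition pospart (a : R) : R := Num.max a 0.

Definition p eps c r x u : R :=
  (pospart (x 0 ^+ 2 - x (- r) ^+ 2 - 2 * inner r x u) + c * r * x 0 ^+ 2)
  / (2 * (norm2 r x ^+ 2 + pospart (eps ^+ 2 - x 0 ^+ 2))).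

Definition X eps c r x u : Prop :=
  [/\ W1infty (- r) 0 x,
      {within `[- r, 0], continuous u}
    & u 0 = - (p eps c r x u + 2 * c) * x 0].

Definition history (v : R -> R) (t : R) : R -> R := fun s => v (t + s).

(** The real interval [[a, tmax)], with [tmax] possibly [+oo]. *)
Definition upto (a : R) (tmax : \bar R) : set R :=
  [set t | a <= t /\ (t%:E < tmax)%E].

Record is_solution eps c r theta d x0 u0 (tmax : \bar R) x u : Prop := {
  sol_cont_x : {within upto (- r) tmax, continuous x};
  sol_cont_u : {within upto (- r) tmax, continuous u};
  sol_W1infty : forall T : R, (T%:E < tmax)%E -> W1infty (- r) T x;
  sol_init_x : forall s, - r <= s <= 0 -> x s = x0 s;
  sol_init_u : forall s, - r <= s <= 0 -> u s = u0 s;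
  sol_ode : {ae @lebesgue_measure R, forall t, upto 0 tmax t ->
              is_derive t 1 x (theta * x t + u t + d t)};
  sol_feedback : forall t, upto 0 tmax t ->
    u t = - (2 * c + p eps c r (history x t) (history u t)) * x t
}.

End Feedback.

(* Main.v *)
Require Import Defs.
From mathcomp Require Import ring lra measurable_realfun ess_sup_inf.
Set Implicit Arguments.
Unset Strict Implicit.
Unset Printing Implicit Defensive.
Local Open Scope classical_set_scope.
Local Open Scope ring_scope.

(** Take [v = theta x + u] as the only unknown. Then [x = x0 0 + \int d + \int v]
    and [u = v - theta x], and since [p] depends on the histories only through
    [x t], [x (t - r)], [<x_t, u_t>] and [||x_t||^2], the closed loop becomes a
    fixed-point equation [v t = Psi v t] in which [Psi v t] depends on [v] before
    time [t] only, through integrals. The denominator of [p] is positive for every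
    continuous [x], hence bounded below along small perturbations, so [Psi] is
    a contraction on short intervals: this yields local existence, uniqueness
    and a maximal solution. As [p >= 0], [|u| >= 2 c |x|]; so if [u] stays
    bounded up to [tmax] then so does [v], and [Psi v] is a continuous extension
    of [v] to [tmax], contradicting maximality. *)

(** * Calculus on the real line *)

(** With [v] as unknown, rather than [u], the state is a plain primitive of [v + d]: neither
    Gronwall's inequality nor variation of constants is needed. The obstacle is that [u] occurs on
    both sides of the feedback law; inside [p] it is only integrated, which makes the equation
    causal. If two candidates share their past before [tau] and differ by at most [M] afterwards,
    their integrals over [[t - r, t]] differ by [O(M h)] for [t] up to [tau + h], however large [r]
    is: this is the small factor of the contraction. The lower bound of the denominator, hence the
    Lipschitz constant and the step length, depends on the past trajectory, so continuation goes
    through a supremum of times and not through steps of fixed size. As [d] is only essentially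
    bounded, a bounded Borel representative replaces it. Conversely, an almost everywhere solution
    of the ODE is integrated back because an absolutely continuous function whose derivative
    vanishes almost everywhere is constant. *)

Section RealInduction.
Context {R : realType}.

(** The supremum of the times up to which [P] holds without interruption satisfies [P] by the left
    hypothesis; were it below [b], the right hypothesis would carry [P] beyond it. *)
Lemma real_induction (P : R -> Prop) (a b : R) : a <= b -> P a ->
  (forall t, a <= t < b -> (forall s, a <= s <= t -> P s) ->
     exists2 e : R, 0 < e & forall s, t < s < t + e -> s <= b -> P s) ->
  (forall t, a < t <= b -> (forall s, a <= s < t -> P s) -> P t) ->
  forall t, a <= t <= b -> P t.
Proof.
move=> ab Pa Pr Pl.
pose S := [set t | a <= t <= b /\ forall s, a <= s <= t -> P s].
have Sa : S a.
  by split=> [|s]; rewrite ?lexx// -eq_le => /eqP <-.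
have supS : has_sup S by split; [exists a|exists b => t [/andP[]]].
pose m := sup S.
have am : a <= m by apply: ub_le_sup => //; case: supS.
have mb : m <= b by apply: ge_sup; [exists a|move=> t [/andP[]]].
have Plt s : a <= s < m -> P s.
  move=> /andP[as_ sm].
  have [t [tab Pt] st] := sup_gt supS.1 sm.
  by apply: Pt; rewrite as_ ltW.
have Pm : P m.
  by have [<-//|am'] := eqVneq a m; apply: Pl => //; rewrite lt_neqAle am' am.
have Ple s : a <= s <= m -> P s.
  move=> /andP[as_]; rewrite le_eqVlt => /predU1P[->//|sm].
  by apply: Plt; rewrite as_.
have [mb'|bm] := ltP m b; last first.
  by move=> t /andP[at_ tb]; apply: Ple; rewrite at_ (le_trans tb).
have [e e0 Pe] := Pr m (introT andP (conj am mb')) Ple.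
pose s := Num.min b (m + e / 2).
have ms : m < s by rewrite lt_min mb' ltrDl divr_gt0.
suff : s <= m by rewrite leNgt ms.
apply: ub_le_sup; first by case: supS.
split; first by rewrite (le_trans am (ltW ms))/= ge_min lexx.
move=> q /andP[aq qs]; have [qm|mq] := leP q m; first by apply: Ple; rewrite aq.
apply: Pe; last by rewrite (le_trans qs)// ge_min lexx.
rewrite mq (le_lt_trans qs)// gt_min; apply/orP; right.
by rewrite ltrD2l ltr_pdivrMr// mulr_natr mulr2n ltrDl.
Qed.

End RealInduction.

(** * Primitives of locally bounded Borel functions *)

Section BoundedPrimitives.
Context {R : realType}.
Local Notation mu := (@lebesgue_measure R).
Implicit Types (f g : R -> R) (I : set R).

Lemma ae_sub2 (P Q S : set R) : (forall t, P t -> Q t -> S t) ->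
  {ae mu, forall t, P t} -> {ae mu, forall t, Q t} -> {ae mu, forall t, S t}.
Proof.
move=> PQS; apply: filterS2 PQS; exact: (ae_filter_ringOfSetsType mu).
Qed.

Lemma ae_sub (P Q : set R) : (forall t, P t -> Q t) ->
  {ae mu, forall t, P t} -> {ae mu, forall t, Q t}.
Proof. by move=> PQ aeP; apply: (ae_sub2 _ aeP aeP) => t /PQ. Qed.

(** Trades an [L^oo] class for a representative bounded at every point, whose primitive is then
    Lipschitz. *)
Lemma LinftyP I f : Linfty I f <-> exists g B,
  [/\ measurable_fun setT g, forall t, `|g t| <= B
    & {ae mu, forall t, I t -> f t = g t}].
Proof.
have muT : (0 < mu [set: R])%E.
  have -> : [set: R] = `]-oo, +oo[%classic by rewrite set_itvE.
  by rewrite lebesgue_measure_itv/= ?ltNyr ?lt0y//.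
split=> [[g gL fg]|[g [B [mg gB fg]]]].
  have mg : measurable_fun setT g by have := sub_Lfun_mfun gL; rewrite inE.
  have : (Lnorm mu +oo (EFin \o g) < +oo)%E.
    by have := sub_Lfun_finLfun gL; rewrite inE.
  rewrite unlock /Lnorm muT => gfin.
  have [B gB] := @ess_supr_bounded _ _ _ mu (Num.norm \o g) gfin.
  (* Truncation changes [g] only where its modulus exceeds the essential bound; the absolute value
     keeps the two truncation levels in order. *)
  pose h t := Num.max (- `|B|) (Num.min (g t) `|B|).
  exists h, `|B|; split.
  - apply: measurable_maxr; first exact: measurable_cst.
    by apply: measurable_minr => //; exact: measurable_cst.
  - move=> t; rewrite ler_norml /h ge_max le_max lexx/= ge_min lexx orbT andbT.
    by rewrite (le_trans _ (normr_ge0 _))// oppr_le0.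
  - apply: (ae_sub2 _ fg gB) => t fgt gBt It; rewrite fgt// /h.
    have : `|g t| <= `|B| by rewrite (le_trans gBt)// ler_norm.
    by rewrite ler_norml => /andP[g1 g2]; rewrite min_l// max_r.
exists g => //; rewrite inE; apply/andP; split; rewrite inE//=.
rewrite /finite_norm unlock /Lnorm muT.
apply: (@le_lt_trans _ _ B%:E); last exact: ltry.
by apply: ess_sup_ler => t; rewrite lee_fin.
Qed.

Lemma continuous_atP f t : {for t, continuous f} <->
  forall e : R, 0 < e -> exists2 d : R, 0 < d &
    forall s, `|s - t| < d -> `|f s - f t| <= e.
Proof.
split=> [/cvgrPdist_le cf e e0|cf].
  have /nbhs_ballP[d /= d0 fd] := cf e e0.
  by exists d => // s st; rewrite distrC; apply: fd; rewrite /= /ball/= distrC.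
apply/cvgrPdist_le => e /cf[d d0 fd]; apply/nbhs_ballP; exists d => // s /=.
by rewrite /ball/= distrC => /fd; rewrite distrC.
Qed.

(** Continuity is not demanded, because [Psi] must also accept a solution cut off at a finite time
    where no limit is known yet. *)
Definition adm (b : R) f := measurable_fun setT f /\
  forall T, exists B, forall t, b <= t <= T -> `|f t| <= B.

Lemma within_bounded f (a b : R) : {within `[a, b], continuous f} ->
  exists B, forall t, a <= t <= b -> `|f t| <= B.
Proof.
move=> cf; have [ab|ba] := leP a b; last first.
  exists 0 => t /andP[at_ tb]; have := le_trans at_ tb.
  by rewrite leNgt ba.
have /= [s _ sM] := EVT_max ab cf.
have /= [q _ qm] := EVT_min ab cf.
exists (Num.max `|f s| `|f q|) => t tab.
have tI : t \in `[a, b]%R by rewrite in_itv.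
rewrite le_max; have [ft0|ft0] := leP 0 (f t).
  by rewrite ger0_norm// (le_trans (sM t tI))// ler_norm.
rewrite ltr0_norm// orbC (le_trans (y := - f q))//.
  by rewrite lerN2 qm.
by rewrite (le_trans (ler_norm _))// normrN.
Qed.

Lemma continuous_adm b f : continuous f -> adm b f.
Proof.
move=> cf; split; first exact: continuous_measurable_fun.
by move=> T; apply: within_bounded; exact: continuous_subspaceT.
Qed.

Lemma admD b f g : adm b f -> adm b g -> adm b (fun t => f t + g t).
Proof.
move=> [mf Bf] [mg Bg]; split; first exact: measurable_funD.
move=> T; have [B fB] := Bf T; have [C gC] := Bg T; exists (B + C) => t tT.
by rewrite (le_trans (ler_normD _ _))// lerD ?fB ?gC.
Qed.

Lemma admM b f g : adm b f -> adm b g -> adm b (fun t => f t * g t).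
Proof.
move=> [mf Bf] [mg Bg]; split; first exact: measurable_funM.
move=> T; have [B fB] := Bf T; have [C gC] := Bg T; exists (B * C) => t tT.
by rewrite normrM ler_pM ?fB ?gC.
Qed.

Lemma adm_cst b (k : R) : adm b (fun=> k).
Proof. by split; [exact: measurable_cst|move=> T; exists `|k|]. Qed.

Lemma admB b f g : adm b f -> adm b g -> adm b (fun t => f t - g t).
Proof.
move=> af ag; have := admD af (admM (adm_cst b (-1)) ag).
by under eq_fun do rewrite mulN1r.
Qed.

Lemma adm_integrable b f (s t : R) : adm b f -> b <= s ->
  mu.-integrable `[s, t] (EFin \o f).
Proof.
move=> [mf Bf] bs; apply: measurable_bounded_integrable => //.
- by rewrite /= lebesgue_measure_itv/=; case: ifPn => // _; rewrite -EFinD ltry.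
- exact: measurable_funS mf.
- have [B fB] := Bf t; exists B; split; first exact: num_real.
  move=> C BC q /=; rewrite in_itv/= => /andP[sq qt].
  by rewrite (le_trans _ (ltW BC))// fB// (le_trans bs).
Qed.

Definition prim (b : R) f t : R := \int[mu]_(s in `[b, t]) f s.

Lemma primB b f s t : adm b f -> b <= s <= t ->
  prim b f t - prim b f s = \int[mu]_(q in `[s, t]) f q.
Proof.
move=> af /andP[bs st].
have int : mu.-integrable `[b, t] (EFin \o f) by exact: adm_integrable af _.
rewrite /prim (Rintegral_itvB int) ?bnd_simp//.
rewrite Rintegral_itv_obnd_cbnd//.
by apply: integrableS (adm_integrable t af bs) => //; apply: subset_itvr; rewrite bnd_simp.
Qed.

(** The bound is asked on [[s, t[] only, since a point is negligible. This is where the strict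
    inequality in the causality lemmas comes from. *)
Lemma prim_dist b f g s t M : adm b f -> adm b g -> b <= s <= t ->
  (forall q, s <= q < t -> `|f q - g q| <= M) ->
  `|(prim b f t - prim b f s) - (prim b g t - prim b g s)| <= M * (t - s).
Proof.
move=> af ag /andP[bs]; rewrite le_eqVlt => /predU1P[<-|st] fgM.
  by rewrite !subrr normr0 mulr0.
have bst : b <= s <= t by rewrite bs ltW.
rewrite !primB// -RintegralB//; try exact: adm_integrable bs.
have afg := admB af ag.
have Ico h : adm b h -> mu.-integrable `[s, t[ (EFin \o h).
  move=> ah; apply: integrableS (adm_integrable t ah bs) => //.
  by apply: subset_itvl; rewrite bnd_simp.
rewrite -Rintegral_itv_bndo_bndc; last exact: (Ico _ afg).
rewrite (le_trans (le_normr_Rintegral _ (Ico _ afg)))//.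
have : \int[mu]_(q in `[s, t[) `|f q - g q| <= \int[mu]_(q in `[s, t[) M.
  apply: le_Rintegral => //.
  - by apply: integrable_norm; exact: (Ico _ afg).
  - exact: (Ico _ (adm_cst b M)).
move=> /le_trans; apply.
by rewrite Rintegral_cst//= lebesgue_measure_itv/= lte_fin st -EFinD.
Qed.

Lemma prim_ext b f g s t : adm b f -> adm b g -> b <= s <= t ->
  (forall q, s <= q < t -> f q = g q) ->
  prim b f t - prim b f s = prim b g t - prim b g s.
Proof.
move=> af ag bst fg; apply/eqP; rewrite -subr_eq0 -normr_le0.
rewrite (le_trans (prim_dist (M := 0) af ag bst _)) ?mul0r// => q /fg ->.
by rewrite subrr normr0.
Qed.

Lemma prim_lip b f s t M : adm b f -> b <= s <= t ->
  (forall q, s <= q < t -> `|f q| <= M) ->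
  `|prim b f t - prim b f s| <= M * (t - s).
Proof.
move=> af bst fM.
have := prim_dist (M := M) af (adm_cst b 0) bst.
rewrite [X in _ - X](_ : _ = 0); first by rewrite subr0; apply=> q /fM; rewrite subr0.
by rewrite primB//; [rewrite Rintegral_cst// mul0r|exact: adm_cst].
Qed.

Lemma prim_continuous b f t : adm b f -> b < t -> {for t, continuous (prim b f)}.
Proof.
move=> af bt; apply/continuous_atP => e e0.
have [B fB] := af.2 (t + 1).
have B1 : 0 < `|B| + 1 by rewrite ltr_pwDr.
have P q s : b <= q -> q <= s -> s <= t + 1 ->
    `|prim b f s - prim b f q| <= (`|B| + 1) * (s - q).
  move=> bq qs st; apply: prim_lip => //; first by rewrite bq.
  move=> p /andP[qp ps]; apply: (le_trans (fB p _)).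
    by rewrite (le_trans bq qp)/= (le_trans (ltW ps)).
  by rewrite (le_trans (ler_norm _))// lerDl.
exists (Num.min (Num.min 1 (t - b)) (e / (`|B| + 1))).
  by rewrite !lt_min ltr01 subr_gt0 bt divr_gt0.
move=> s; rewrite !lt_min ltr_pdivlMr// mulrC => /andP[/andP[s1 s2] s3].
apply: le_trans (ltW s3).
move: s1 s2; rewrite !ltr_norml => s1 s2.
have [st|ts] := leP s t.
  rewrite distrC (_ : `|s - t| = t - s) ?P//; try lra.
  by rewrite distrC ger0_norm ?subr_ge0.
rewrite (_ : `|s - t| = s - t) ?P//; try lra.
by rewrite gtr0_norm ?subr_gt0.
Qed.

Lemma prim_is_derive (b t : R) f : continuous f -> b < t ->
  is_derive t 1 (prim b f) (f t).
Proof.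
move=> cf bt.
have [] := @continuous_FTC1_closed R f b t (t + 1).
- by rewrite ltrDl.
- exact: adm_integrable (continuous_adm b cf) _.
- by [].
- exact: cf.
move=> dF; rewrite derive1E => <-; exact: derivableP.
Qed.

Lemma prim_ae_derive (b : R) f : measurable_fun setT f ->
  (exists B, forall t, `|f t| <= B) ->
  {ae mu, forall t, b < t -> is_derive t 1 (prim b f) (f t)}.
Proof.
move=> mf [B fB].
have af c : adm c f by split=> // T; exists B => t _.
have locf : locally_integrable [set: R] f.
  split=> //; first exact: openT.
  move=> K _ cK; have := compact_bounded cK => -[M [_ MK]].
  have KI : K `<=` `[- (M + 1), M + 1]%classic.
    move=> x /MK /= /(_ (M + 1)); rewrite ltrDl ltr01 => /(_ isT).
    by rewrite ler_norml in_itv.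
  have /integrableP[_] := adm_integrable (M + 1) (af _) (lexx (- (M + 1))).
  apply: le_lt_trans; apply: ge0_subset_integral => //.
  - exact: compact_measurable.
  - apply/measurable_EFinP; apply: measurableT_comp => //.
    exact: measurable_funS mf.
have := @FTC1 R f (BLeft b) (fun t => adm_integrable t (af b) (lexx b)) locf.
apply: ae_sub => t Ht bt; have [|dF] := Ht; first by rewrite /= lte_fin.
rewrite derive1E => <-; exact: derivableP.
Qed.

End BoundedPrimitives.

(** * Absolute continuity and derivatives vanishing almost everywhere *)

Section AbsoluteContinuity.
Context {R : realType}.
Local Notation mu := (@lebesgue_measure R).
Implicit Types (f g z : R -> R) (I J : set R).

Lemma abs_cont_sub I J f : I `<=` J -> abs_cont J f -> abs_cont I f.
Proof.
move=> IJ ac e e0; have [d d0 acd] := ac e e0; exists d => // n a b ab.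
by apply: acd => i; have [Ia Ib aib] := ab i; split=> //; exact: IJ.
Qed.

Lemma abs_contD I f g : abs_cont I f -> abs_cont I g ->
  abs_cont I (fun t => f t + g t).
Proof.
move=> acf acg e e0; have e2 : 0 < e / 2 by rewrite divr_gt0.
have [d d0 fd] := acf _ e2; have [d' d'0 gd] := acg _ e2.
exists (Num.min d d'); first by rewrite lt_min d0.
move=> n a b ab tab; rewrite lt_min => /andP[abd abd'].
rewrite [e]splitr; apply: le_lt_trans (ltrD (fd _ _ _ ab tab abd) (gd _ _ _ ab tab abd')).
rewrite -big_split/=; apply: ler_sum => i _.
by rewrite opprD addrACA ler_normD.
Qed.

Lemma lipschitz_abs_cont I f (L : R) : 0 <= L ->
  (forall s t, I s -> I t -> s <= t -> `|f t - f s| <= L * (t - s)) ->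
  abs_cont I f.
Proof.
move=> L0 fL e e0; have L1 : 0 < L + 1 by rewrite ltr_wpDl.
exists (e / (L + 1)); first exact: divr_gt0.
move=> n a b ab _; rewrite ltr_pdivlMr// mulrC => abe.
apply: le_lt_trans abe; rewrite mulr_sumr; apply: ler_sum => i _.
have [Ia Ib aib] := ab i; rewrite (le_trans (fL _ _ Ia Ib aib))//.
by rewrite ler_wpM2r ?subr_ge0// lerDl.
Qed.

Lemma is_derive_slope z (t d e : R) : is_derive t 1 z d -> 0 < e ->
  exists2 rho : R, 0 < rho & forall s, `|s - t| < rho ->
    `|z s - z t - d * (s - t)| <= e * `|s - t|.
Proof.
move=> /is_derive1_caratheodory[g [zg /continuous_atP cg gt]] e0.
have [rho rho0 grho] := cg e e0; exists rho => // s /grho.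
by rewrite gt zg -mulrBl normrM => ?; rewrite ler_wpM2r.
Qed.

(** Lets ordered intervals inside an open set of small measure meet the smallness condition of
    [abs_cont]: the ordering makes them disjoint, so their lengths add up to the measure of their
    union. *)
Lemma sum_disjoint_itv_le n (a b : nat -> R) (U : set R) : open U ->
  (forall i, (i < n)%N -> a i <= b i /\ `]a i, b i[ `<=` U) ->
  (forall i j, (i < j < n)%N -> b i <= a j) ->
  trivIset setT (fun i : 'I_n => `]a i, b i[%classic) /\
  ((\sum_(i < n) (b i - a i))%:E <= mu U)%E.
Proof.
move=> oU ab ba.
have tab : trivIset setT (fun i : 'I_n => `]a i, b i[%classic).
  apply/trivIsetP => i j _ _ ij; apply/seteqP; split=> // x /=.
  rewrite !in_itv/= => -[/andP[xi1 xi2] /andP[xj1 xj2]].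
  wlog : i j ij xi1 xi2 xj1 xj2 / (i < j)%N => [hw|lij].
    have [|ji|/val_inj eij] := ltngtP i j; first exact: (hw i j).
      by apply: (hw j i) => //; rewrite eq_sym.
    by rewrite eij eqxx in ij.
  have := ba i j; rewrite lij ltn_ord => /(_ isT).
  by move=> /(lt_le_trans xi2)/(lt_trans xj1); rewrite ltxx.
split=> //.
pose V := \big[setU/set0]_(i < n) `]a i, b i[%classic.
have mV : mu V = (\sum_(i < n) (b i - a i))%:E.
  rewrite /V measure_bigsetU_ord// -sumEFin; apply: eq_bigr => i _.
  rewrite /= lebesgue_measure_itv/= lte_fin.
  case: ltP => [_|bia]; first by rewrite -EFinD.
  have := (ab i (ltn_ord i)).1; rewrite -[_ <= _]subr_ge0 => abi.
  by apply/eqP; rewrite eqe eq_le abi subr_le0 bia.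
rewrite -mV; apply: le_measure; rewrite ?inE.
- by apply: bigsetU_measurable => i _; exact: measurable_itv.
- exact: open_measurable.
by rewrite /V; elim/big_ind : _ => // [A B AU BU|i _]; [move=> x [/AU|/BU]|exact: (ab i _).2].
Qed.

(* Real induction replaces a Cousin partition: up to [t], the increment of [z]
   is controlled by [e * (t - a)] plus the increments over finitely many disjoint
   intervals contained in an open set of small measure covering the exceptional
   null set. *)
Lemma abs_cont_derive0_cst z (a b : R) : a <= b -> abs_cont `[a, b] z ->
  {ae mu, forall t, a <= t <= b -> is_derive t 1 z 0} -> z b = z a.
Proof.
move=> ab ac [A [mA A0 zA]].
apply/eqP; rewrite -subr_eq0 -normr_le0; apply/ler_addgt0Pl => e0 e0_gt0.
rewrite addr0.
(* The slopes will cost [e * (b - a)] and the intervals inside [U] less than [e], which together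
   make [e0]. *)
pose e := e0 / (b - a + 1).
have ba1 : 0 < b - a + 1 by rewrite ltr_wpDl// subr_ge0.
have e_gt0 : 0 < e by exact: divr_gt0.
have [d d0 acd] := ac e e_gt0.
have [U [oU AU mU]] : exists U : set R, [/\ open U, A `<=` U & (mu U < d%:E)%E].
  have A0' : lebesgue_measure A = 0%E := A0.
  have Afin : (lebesgue_measure A < +oo)%E by rewrite A0'.
  have [U [oU AU mU]] := lebesgue_regularity_outer mA Afin d0.
  exists U; split=> //; rewrite -(setDUK AU) (le_lt_trans (measureU2 _ _ _))//.
    by apply: measurableD => //; exact: open_measurable.
  by rewrite [X in (X + _ < _)%E]A0 add0e.
pose P t := exists n (s q : nat -> R),
  [/\ forall i, (i < n)%N -> [/\ a <= s i, s i <= q i, q i <= t & `]s i, q i[ `<=` U],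
      forall i j, (i < j < n)%N -> q i <= s j
    & `|z t - z a| <= e * (t - a) + \sum_(i < n) `|z (q i) - z (s i)| ].
(* Both clauses of the induction are jumps from [s] to [q] across [t]. If [t] lies in [U], the jump
   becomes one more interval of the list; otherwise [z] has derivative 0 at [t] and the jump costs
   at most [e * (q - s)]. *)
have step t : a <= t <= b -> exists2 rho : R, 0 < rho & forall s q,
    a <= s -> s <= t <= q -> t - rho < s -> q < t + rho -> P s -> P q.
  move=> tab; have [tU|tU] := pselect (U t).
    have [rho /= rho0 Ur] : exists2 rho, 0 < rho & ball t rho `<=` U.
      by have /nbhs_ballP := open_nbhs_nbhs (conj oU tU).
    exists rho => // s q as_ /andP[st tq] rs qr [n [u [v [uv vu zs]]]].
    have sq := le_trans st tq.
    exists n.+1, (fun i => if (i < n)%N then u i else s),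
      (fun i => if (i < n)%N then v i else q); split.
    - move=> i; rewrite ltnS leq_eqVlt => /predU1P[->|i_n].
        rewrite ltnn; split=> // x /=; rewrite in_itv/= => /andP[sx xq].
        by apply: Ur; rewrite /ball/= ltr_norml; apply/andP; split; lra.
      by rewrite i_n; have [? ? vs ?] := uv i i_n; split=> //; exact: le_trans sq.
    - move=> i j /andP[ij]; rewrite ltnS leq_eqVlt => /predU1P[jn|j_n].
        rewrite jn ltnn -jn ij; rewrite jn in ij.
        by have [] := uv i ij.
      by rewrite (ltn_trans ij j_n) j_n vu// ij.
    rewrite big_ord_recr/= ltnn; under eq_bigr do rewrite ltn_ord.
    rewrite -(subrKA (z s)) (le_trans (ler_normD _ _))//.
    have : e * (s - a) <= e * (q - a) by rewrite ler_wpM2l ?(ltW e_gt0)// lerD2r.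
    move: zs; lra.
  have /is_derive_slope/(_ e_gt0)[rho rho0 zr] : is_derive t 1 z 0.
    by apply: contrapT => nz; apply/tU/AU/zA => /(_ tab).
  exists rho => // s q as_ /andP[st tq] rs qr [n [u [v [uv vu zs]]]].
  exists n, u, v; split=> //.
    move=> i /uv[? ? vs ?]; split=> //; exact: le_trans vs (le_trans st tq).
  have /zr : `|s - t| < rho by rewrite ltr_norml; apply/andP; split; lra.
  have /zr : `|q - t| < rho by rewrite ltr_norml; apply/andP; split; lra.
  have -> : `|q - t| = q - t by rewrite ger0_norm ?subr_ge0.
  have -> : `|s - t| = t - s by rewrite distrC ger0_norm ?subr_ge0.
  rewrite !mul0r !subr0 (distrC (z s)) => zq zst.
  have := ler_normD (z q - z t) (z t - z s + (z s - z a)).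
  have := ler_normD (z t - z s) (z s - z a).
  rewrite !subrKA => h1 h2; nra.
have Pa : P a.
  by exists 0%N, (fun=> 0), (fun=> 0); split=> //; rewrite big_ord0 !subrr normr0 mulr0 addr0.
have [n [s [q [sq qs zb]]]] : P b.
  apply: (real_induction ab Pa); last by rewrite ab lexx.
  - move=> t /andP[at_ tb] Pt; have [|rho rho0 Pr] := step t; first by rewrite at_ ltW.
    exists rho => // q /andP[tq qr] _; apply: (Pr t) => //; rewrite ?lexx ?(ltW tq)//.
      by rewrite ltrBlDr ltrDl.
    by apply: Pt; rewrite at_ lexx.
  - move=> t /andP[at_ tb] Pt; have [|rho rho0 Pr] := step t; first by rewrite ltW.
    have rho2 : rho / 2 < rho by rewrite ltr_pdivrMr// mulr_natr mulr2n ltrDl.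
    have rho20 : 0 < rho / 2 by rewrite divr_gt0.
    have mt : Num.max a (t - rho / 2) < t by rewrite gt_max at_/=; lra.
    apply: (Pr (Num.max a (t - rho / 2))).
    + by rewrite le_max lexx.
    + by rewrite lexx andbT ltW.
    + by rewrite lt_max; apply/orP; right; lra.
    + by rewrite ltrDl.
    + by apply: Pt; rewrite mt le_max lexx.
have [|tsq sumsq] := sum_disjoint_itv_le oU _ qs; first by move=> i /sq[].
have : \sum_(i < n) `|z (q i) - z (s i)| < e.
  apply: acd => //.
    move=> i; have [? ? ? _] := sq i (ltn_ord i); split=> //=; rewrite in_itv/=.
      by apply/andP; split=> //; apply: (le_trans (y := q i)).
    by apply/andP; split=> //; apply: (le_trans (y := s i)).
  by rewrite -lte_fin; exact: le_lt_trans sumsq mU.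
move=> se; apply: (le_trans zb); rewrite (_ : e0 = e * (b - a) + e).
  by rewrite lerD2l ltW.
by rewrite /e; field; rewrite gt_eqF.
Qed.

End AbsoluteContinuity.

(** * Bounds and Lipschitz constants of compound expressions *)

Section LipschitzCalculus.
Context {R : realType}.
Implicit Types a b K C e : R.

(* [K] bounds and [C * e] separates; the closure lemmas below compute the Lipschitz
   constant of an expression along with the bounds it needs. *)
Definition near2 K C e a a' := [/\ `|a| <= K, `|a'| <= K & `|a - a'| <= C * e].

Lemma near2D K1 C1 K2 C2 e a a' b b' :
  near2 K1 C1 e a a' -> near2 K2 C2 e b b' ->
  near2 (K1 + K2) (C1 + C2) e (a + b) (a' + b').
Proof.
move=> [a1 a2 a3] [b1 b2 b3]; split.
- by rewrite (le_trans (ler_normD _ _))// lerD.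
- by rewrite (le_trans (ler_normD _ _))// lerD.
- by rewrite opprD addrACA (le_trans (ler_normD _ _))// mulrDl lerD.
Qed.

Lemma near2N K C e a a' : near2 K C e a a' -> near2 K C e (- a) (- a').
Proof. by move=> [a1 a2 a3]; split; rewrite -?opprD normrN. Qed.

Lemma near2M K1 C1 K2 C2 e a a' b b' :
  near2 K1 C1 e a a' -> near2 K2 C2 e b b' ->
  near2 (K1 * K2) (K1 * C2 + K2 * C1) e (a * b) (a' * b').
Proof.
move=> [a1 a2 a3] [b1 b2 b3]; split.
- by rewrite normrM ler_pM.
- by rewrite normrM ler_pM.
rewrite (_ : a * b - a' * b' = a * (b - b') + b' * (a - a')); last by ring.
by rewrite (le_trans (ler_normD _ _))// !normrM mulrDl -!mulrA lerD// ler_pM.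
Qed.

Lemma near2_cst e k : near2 `|k| 0 e k k.
Proof. by split; rewrite // subrr normr0 mul0r. Qed.

Lemma pospart_dist a b : `|pospart a - pospart b| <= `|a - b|.
Proof.
rewrite /pospart; case: (leP a 0) => a0; case: (leP b 0) => b0;
  have := ler_norm (a - b); have := ler_norm (b - a); rewrite (distrC b a);
  rewrite ler_norml => ? ?; apply/andP; split; lra.
Qed.

Lemma pospart_norm a : `|pospart a| <= `|a|.
Proof. by have := pospart_dist a 0; rewrite /pospart maxxx !subr0. Qed.

Lemma pospart_ge0 a : 0 <= pospart a.
Proof. by rewrite /pospart le_max lexx orbT. Qed.

Lemma near2_pospart K C e a a' : near2 K C e a a' ->
  near2 K C e (pospart a) (pospart a').
Proof.
move=> [a1 a2 a3]; split; [exact: le_trans (pospart_norm _) _ |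
  exact: le_trans (pospart_norm _) _ | exact: le_trans (pospart_dist _ _) _].
Qed.

Lemma near2V K C e m a a' : 0 < m -> m <= a -> m <= a' -> near2 K C e a a' ->
  near2 m^-1 (m^-1 * m^-1 * C) e a^-1 a'^-1.
Proof.
move=> m0 ma ma' [_ _ aa'].
have a0 : 0 < a := lt_le_trans m0 ma; have a'0 : 0 < a' := lt_le_trans m0 ma'.
have V x : 0 < x -> m <= x -> `|x^-1| <= m^-1.
  by move=> x0 mx; rewrite gtr0_norm ?invr_gt0// lef_pV2.
split; [exact: V|exact: V|].
rewrite (_ : a^-1 - a'^-1 = a^-1 * a'^-1 * (a' - a)); last by field; rewrite !gt_eqF.
rewrite (_ : _ * C * e = m^-1 * m^-1 * (C * e)); last by ring.
by rewrite !normrM (distrC a') ler_pM ?mulr_ge0// ler_pM// V.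
Qed.

Lemma continuous_maxr a : continuous (fun t : R => Num.max t a).
Proof.
move=> t; apply/continuous_atP => e e0; exists e => // s st.
have E x : Num.max x a = pospart (x - a) + a.
  by rewrite /pospart addr_maxl subrK add0r.
rewrite !E opprD addrACA subrr addr0 (le_trans (pospart_dist _ _))//.
by rewrite opprB addrA subrK ltW.
Qed.

(** Meant for the denominator of [p]: half of its reference value [e' + q'] remains as long as the
    drops [A] and [B] of its two terms are small enough. *)
Lemma half_le_lin (e e' q q' A B : R) : A + B <= (e' + q') / 2 ->
  - A <= e - e' -> - B <= q - q' -> (e' + q') / 2 <= e + q.
Proof. lra. Qed.

End LipschitzCalculus.

Lemma continuous_at_comp (R : realType) (f g : R -> R) t :
  {for t, continuous f} -> {for f t, continuous g} ->
  {for t, continuous (fun x => g (f x))}.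
Proof. exact: continuous_comp. Qed.

Lemma continuous_minr (R : realType) (a : R) (v : R -> R) : continuous v ->
  continuous (fun t => v (Num.min t a)).
Proof.
move=> cv t; apply: (@continuous_at_comp _ (Num.min^~ a) v); last exact: cv.
have -> : Num.min^~ a = (fun t => - Num.max (- t) (- a)).
  by apply/funext => s; rewrite oppr_max !opprK.
apply: (@continuous_at_comp _ (fun t => Num.max (- t) (- a)) -%R); last exact: opp_continuous.
apply: (@continuous_at_comp _ -%R (Num.max^~ (- a))); last exact: continuous_maxr.
exact: opp_continuous.
Qed.

(** * Localising, freezing and gluing functions in time *)

Section WithinContinuity.
Context {R : realType}.
Local Notation mu := (@lebesgue_measure R).
Implicit Types (f g : R -> R) (A : set R) (a b s t e T : R).

Lemma within_continuous_distP A f : {within A, continuous f} <->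
  forall t, A t -> forall e, 0 < e -> exists2 d : R, 0 < d &
    forall s, A s -> `|s - t| < d -> `|f s - f t| <= e.
Proof.
split=> [/subspace_continuousP cf t At e e0|cf].
  have /cvgrPdist_le/(_ e e0) := cf t At.
  rewrite near_withinE => /nbhs_ballP[d /= d0 fd].
  exists d => // s As st; rewrite distrC; apply: fd => //.
  by rewrite /ball/= distrC.
apply/subspace_continuousP => t At; apply/cvgrPdist_le => e e0.
have [d d0 fd] := cf t At e e0.
rewrite near_withinE; apply/nbhs_ballP; exists d => // s /=.
by rewrite /ball/= distrC => st As; rewrite distrC fd.
Qed.

(** Turns data known on an interval into continuous functions on the line, to which the results on
    primitives apply. *)
Lemma clamp_continuous f a b : a <= b -> {within `[a, b], continuous f} ->
  continuous (fun t => f (Num.max (Num.min t b) a)).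
Proof.
move=> ab /within_continuous_distP cf t; apply/continuous_atP => e e0.
have inI s : `[a, b]%classic (Num.max (Num.min s b) a).
  by rewrite /= in_itv/= le_max lexx orbT ge_max ab ge_min lexx orbT.
have [d d0 fd] := cf _ (inI t) e e0.
have cc : continuous (fun t : R => Num.max (Num.min t b) a).
  exact: continuous_minr (@continuous_maxr R a).
have [|d' d'0 cd] := (continuous_atP _ _).1 (cc t) (d / 2); first by rewrite divr_gt0.
exists d' => // s /cd sd; apply: fd; first exact: inI.
by apply: le_lt_trans sd _; rewrite ltr_pdivrMr// mulr_natr mulr2n ltrDl.
Qed.

Lemma continuous_at_sum (I : Type) (l : seq I) (G : I -> R -> R) t :
  (forall i, {for t, continuous (G i)}) ->
  {for t, continuous (fun h => \sum_(i <- l) G i h)}.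
Proof.
move=> cG; elim: l => [|i l IH].
  have -> : (fun h => \sum_(i <- [::]) G i h) = (fun=> 0).
    by apply/funext => h; rewrite big_nil.
  exact: cvg_cst.
have -> : (fun h => \sum_(j <- i :: l) G j h) = (fun h => G i h + \sum_(j <- l) G j h).
  by apply/funext => h; rewrite big_cons.
by apply: cvgD; [exact: cG|exact: IH].
Qed.

Lemma continuous_near_eq f g t d : 0 < d -> (forall s, `|s - t| < d -> f s = g s) ->
  {for t, continuous f} -> {for t, continuous g}.
Proof.
move=> d0 fg /continuous_atP cf; apply/continuous_atP => e e0.
have [d' d'0 fd] := cf e e0; exists (Num.min d d'); first by rewrite lt_min d0.
move=> s; rewrite lt_min => /andP[sd sd'].
by rewrite -(fg s)// -(fg t) ?subrr ?normr0// fd.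
Qed.

Lemma is_derive_near_eq f g t l d : 0 < d -> (forall s, `|s - t| < d -> f s = g s) ->
  is_derive t 1 f l -> is_derive t 1 g l.
Proof.
move=> d0 fg; apply: near_eq_is_derive; apply/nbhs_ballP; exists d => // s.
by rewrite /ball/= distrC; exact: fg.
Qed.

Lemma derive1_near_eq f g t d : 0 < d -> (forall s, `|s - t| < d -> f s = g s) ->
  derive1 f t = derive1 g t.
Proof.
move=> d0 fg; rewrite !derive1E; apply: near_eq_derive; apply/nbhs_ballP.
by exists d => // s; rewrite /ball/= distrC; exact: fg.
Qed.

(* Endpoints sent to [0] leave the open interval: replace [0] by [- h] and let
   [h] tend to [0]. *)
Lemma abs_cont_min0 a f (I : set R) : a < 0 -> continuous f ->
  abs_cont `]a, 0[ f -> I `<=` [set t | a < t] ->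
  abs_cont I (fun t => f (Num.min t 0)).
Proof.
move=> a0 cf ac Ia e e0; have e2 : 0 < e / 2 by rewrite divr_gt0.
have [d d0 fd] := ac _ e2; exists d => // n p q pq tpq pqd.
pose S h := \sum_(i < n) `|f (Num.min (q i) (- h)) - f (Num.min (p i) (- h))|.
have Sh h : 0 < h < - a -> S h < e / 2.
  move=> /andP[h0 ha]; apply: fd.
  - move=> i; have [/Ia/= ap /Ia/= aq pqi] := pq i.
    have inI s : a < s -> `]a, 0[%classic (Num.min s (- h)).
      by move=> as_; rewrite /= in_itv/= lt_min as_ gt_min oppr_lt0 h0 orbT ltrNr ha.
    by split; [exact: inI|exact: inI|rewrite le_min !ge_min pqi lexx orbT].
  (* Cutting at [- h] can only shrink an interval, so the cut intervals inherit disjointness. *)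
  - have sub i x : Num.min (p i) (- h) < x < Num.min (q i) (- h) -> p i < x < q i.
      rewrite gt_min lt_min => /andP[/orP[->|hx] /andP[-> xh]] //.
      by have := lt_trans hx xh; rewrite ltxx.
    by move=> i j _ _ [x [/= xi xj]]; apply: tpq => //; exists x; split;
      rewrite /= in_itv/=; apply: sub; [move: xi|move: xj]; rewrite in_itv.
  - apply: le_lt_trans pqd; apply: ler_sum => i _; have [_ _ pqi] := pq i.
    by case: (leP (q i) (- h)) => ?; case: (leP (p i) (- h)) => ?; lra.
have Scont : {for 0, continuous S}.
  have cm s : {for 0, continuous (fun h => f (Num.min s (- h)))}.
    have -> : (fun h => f (Num.min s (- h))) = (fun h => f (Num.min (- h) s)).
      by apply/funext => h; rewrite minC.
    apply: (@continuous_at_comp _ -%R (fun h => f (Num.min h s))); first exact: opp_continuous.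
    exact: continuous_minr.
  by apply: continuous_at_sum => i; apply: cvg_norm; exact: cvgB (cm (q i)) (cm (p i)).
have -> : \sum_(i < n) `|f (Num.min (q i) 0) - f (Num.min (p i) 0)| = S 0.
  by rewrite /S oppr0.
suff : S 0 <= e / 2.
  by move=> /le_lt_trans; apply; rewrite ltr_pdivrMr// mulr_natr mulr2n ltrDl.
apply/ler_addgt0Pr => e' e'0.
have [d' d'0 Sd] := (continuous_atP _ _).1 Scont e' e'0.
pose h := Num.min (d' / 2) (- a / 2).
have h0 : 0 < h by rewrite lt_min !divr_gt0// oppr_gt0.
have ha : h < - a by rewrite gt_min; apply/orP; right; lra.
have hd : `|h - 0| < d' by rewrite subr0 gtr0_norm// gt_min; apply/orP; left; lra.
have := Sd h hd; rewrite ler_norml => /andP[+ _].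
have := Sh h; rewrite h0 ha => /(_ isT); lra.
Qed.

(** Passes from integrals over a history to differences of primitives: as a function of [s],
    [prim b f (t + s)] is an antiderivative of the shifted integrand. *)
Lemma shifted_integral b r t f : 0 < r -> b < t - r -> continuous f ->
  \int[mu]_(s in `[- r, 0]) f (t + s) = prim b f t - prim b f (t - r).
Proof.
move=> r0 btr cf.
have dF s : - r <= s -> is_derive s 1 (fun s => prim b f (t + s)) (f (t + s)).
  move=> rs.
  have bts : b < t + s by apply: lt_le_trans btr _; rewrite lerD2l.
  have h1 : is_derive (t + s) 1 (prim b f) (f (t + s)) by exact: prim_is_derive.
  have h2 : is_derive s 1 (fun s => t + s) 1.
    by have := is_deriveD (is_derive_cst t s 1) (is_derive_id s 1); rewrite add0r.
  have := is_derive1_comp h1 h2.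
  by rewrite mulr1.
have cF s : - r <= s -> {for s, continuous (fun s => prim b f (t + s))}.
  by move=> /dF [] /derivable1_diffP/differentiable_continuous.
have r00 : - r < 0 by rewrite oppr_lt0.
rewrite /Rintegral (@continuous_FTC2 _ _ (fun s => prim b f (t + s)))//.
- by rewrite addr0.
- apply: continuous_subspaceT => s.
  apply: (@continuous_at_comp _ (fun s => t + s) f); last exact: cf.
  by apply: cvgD; [exact: cvg_cst|exact: cvg_id].
- split.
  + by move=> s; rewrite in_itv/= => /andP[/ltW/dF[]].
  + by apply: cvg_at_right_filter; apply: cF.
  + by apply: cvg_at_left_filter; apply: cF; exact: ltW.
- by move=> s; rewrite in_itv/= => /andP[/ltW/dF[_ <-] _]; rewrite derive1E.
Qed.

Lemma max0_lip s t : s <= t ->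
  0 <= Num.max s 0 <= Num.max t 0 /\ Num.max t 0 - Num.max s 0 <= t - s.
Proof.
by move=> st; case: (leP s 0) => ?; case: (leP t 0) => ?;
  (split; first (apply/andP; split)); lra.
Qed.

Lemma ereal_between s (tmax : \bar R) : (s%:E < tmax)%E ->
  exists2 T : R, s < T & (T%:E < tmax)%E.
Proof.
case: tmax => [q| |] //; rewrite ?lte_fin => sq.
  by exists ((s + q) / 2); rewrite ?lte_fin; lra.
by exists (s + 1); rewrite ?ltry ?ltrDl.
Qed.

Lemma ae_neq0 : {ae mu, forall t, t != 0}.
Proof.
exists [set 0]; split=> //; first exact: lebesgue_measure_set1.
by move=> s /= /negP; rewrite negbK => /eqP.
Qed.

Lemma W1infty_sub a T T' f : T <= T' -> W1infty a T' f -> W1infty a T f.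
Proof.
move=> TT' [cf ac Lf Ld].
have sub : `]a, T[%classic `<=` `]a, T'[%classic.
  by apply: subset_itvl; rewrite bnd_simp.
have Lsub h : Linfty `]a, T'[%classic h -> Linfty `]a, T[%classic h.
  by move=> [k kL hk]; exists k => //; apply: ae_sub hk => t ht /sub.
split; [|exact: abs_cont_sub ac|exact: Lsub|exact: Lsub].
by apply: continuous_subspaceW cf; apply: subset_itvl; rewrite bnd_simp.
Qed.

Lemma W1infty_eq a T f (h : R -> R) : (forall s, s <= T -> f s = h s) ->
  W1infty a T f -> W1infty a T h.
Proof.
move=> fh [/within_continuous_distP cf ac [k kL fk] [k' k'L dfk]]; split.
- apply/within_continuous_distP => t tI e e0; have [q q0 fq] := cf t tI e e0.
  exists q => // s sI /(fq s sI); move: sI tI; rewrite /= !in_itv/=.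
  by move=> /andP[_ /fh ->] /andP[_ /fh ->].
- move=> e /ac[q q0 acq]; exists q => // n p1 p2 p12 tp12 /(acq _ _ _ p12 tp12).
  congr (_ < _); apply: eq_bigr => i _; have [/= + + _] := p12 i.
  by rewrite !in_itv/= => /andP[_ /ltW/fh ->] /andP[_ /ltW/fh ->].
- exists k => //; apply: ae_sub fk => t ft tI; rewrite -ft//.
  by move: tI; rewrite /= in_itv/= => /andP[_ /ltW/fh].
- exists k' => //; apply: ae_sub dfk => t ft tI; rewrite -ft//.
  move: tI; rewrite /= in_itv/= => /andP[_ tT].
  apply: (@derive1_near_eq _ _ _ (T - t)); first by rewrite subr_gt0.
  by move=> s; rewrite ltr_norml ltrD2r => /andP[_ /ltW/fh].
Qed.

Lemma half_ball (a h t : R) : 0 < h -> a - h / 2 < t -> t < a -> ball a h t.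
Proof.
by rewrite /ball/= ltr_norml => h0 at_ ta; apply/andP; split; lra.
Qed.

End WithinContinuity.

(** * Maximal solutions of causal fixed-point equations *)

Section CausalFixpoint.
Context {R : realType}.
Implicit Types (v w : R -> R) (s t tau h M T : R).

Lemma le0_geometric (x C : R) : (forall n, x <= C / 2 ^+ n) -> x <= 0.
Proof.
move=> xC; rewrite leNgt; apply/negP => x0.
have C0 : 0 < C by have := xC 0%N; rewrite expr0 divr1; exact: lt_le_trans.
have := archi_boundP (ltW (divr_gt0 C0 x0)); set n := Num.bound _ => nx.
have := xC n; rewrite leNgt => /negP; apply.
rewrite ltr_pdivrMr ?exprn_gt0// mulrC -ltr_pdivrMr// (lt_le_trans nx)//.
by rewrite -natrX ler_nat ltnW// ltn_expl.
Qed.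

(** The intervals of radius [2 / 2 ^+ n] around [u n] meet pairwise, so the supremum of their left
    ends belongs to all of them. *)
Lemma geometric_limit (u : nat -> R) :
  (forall n, `|u n.+1 - u n| <= 1 / 2 ^+ n) ->
  exists l, forall n, `|l - u n| <= 2 / 2 ^+ n.
Proof.
move=> u1.
(* Subtracting the tail that remains makes the bound telescope, so that the induction on [k]
   closes. *)
have um k n : `|u (n + k)%N - u n| <= 2 / 2 ^+ n - 2 / 2 ^+ (n + k).
  elim: k => [|k IH]; first by rewrite addn0 !subrr normr0.
  rewrite addnS -(subrKA (u (n + k)%N)) (le_trans (ler_normD _ _))//.
  have := u1 (n + k)%N.
  have -> : 2 / 2 ^+ (n + k).+1 = 1 / 2 ^+ (n + k) :> R.
    by rewrite exprS invfM mulrA divff// ?pnatr_eq0.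
  move: IH; have -> : 2 / 2 ^+ (n + k) = 2 * (1 / 2 ^+ (n + k)) :> R by rewrite mul1r.
  lra.
have p0 n : 0 < 2 / 2 ^+ n :> R by rewrite divr_gt0// exprn_gt0.
have umn m n : u m - 2 / 2 ^+ m <= u n + 2 / 2 ^+ n.
  have [mn|nm] := leqP m n.
    have := um (n - m)%N m; rewrite subnKC// ler_norml => /andP[h _].
    have := p0 n; have := p0 m; lra.
  have := um (m - n)%N n; rewrite subnKC ?(ltnW nm)// ler_norml => /andP[_ h].
  have := p0 n; have := p0 m; lra.
pose S := range (fun n => u n - 2 / 2 ^+ n).
have S0 : S !=set0 by exists (u 0%N - 2 / 2 ^+ 0); exists 0%N.
exists (sup S) => n; rewrite ler_distl; apply/andP; split.
  apply: ub_le_sup; last by exists n.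
  by exists (u 0%N + 2 / 2 ^+ 0) => _ [m _ <-].
by apply: ge_sup => // _ [m _ <-].
Qed.

(** In [Psi_contraction], [v] serves only to fix the common past before [tau] and the centre
    [Psi v tau] of a unit ball; [h0] may depend on both but not on [w] and [w']. The ball condition
    is there because the operator is only locally Lipschitz. The conclusion includes the endpoint
    [tau + h], although the hypotheses stop short of it. *)
Context (b : R) (Psi : (R -> R) -> R -> R).
Context (Psi_continuous : forall v, adm b v -> continuous (Psi v)).
Context (Psi_base : forall v w t, t <= 0 -> Psi v t = Psi w t).
Context (Psi_causal : forall v w t, adm b v -> adm b w ->
  (forall s, s < t -> v s = w s) -> Psi v t = Psi w t).
Context (Psi_contraction : forall v tau, adm b v -> 0 <= tau ->
  exists2 h0 : R, 0 < h0 & forall h w w', 0 < h <= h0 -> adm b w -> adm b w' ->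
    (forall s, s < tau -> w s = v s) -> (forall s, s < tau -> w' s = v s) ->
    (forall s, tau <= s < tau + h -> `|w s - Psi v tau| <= 1) ->
    (forall s, tau <= s < tau + h -> `|w' s - Psi v tau| <= 1) ->
    forall M, (forall s, tau <= s < tau + h -> `|w s - w' s| <= M) ->
    forall t, tau <= t <= tau + h -> `|Psi w t - Psi w' t| <= M / 2).

(** The equation also covers all negative times, where [Psi_base] fixes the value; beyond [T] the
    function is arbitrary apart from continuity. *)
Definition sol_upto T w := continuous w /\ forall t, t <= T -> w t = Psi w t.

(** Real induction on the time of agreement: causality carries equality to a left limit, and
    iterating the contraction carries it past a time already reached. *)
Lemma sol_upto_unique T w w' : sol_upto T w -> sol_upto T w' ->
  forall t, t <= T -> w t = w' t.
Proof.
move=> [cw wP] [cw' w'P].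
have aw := continuous_adm b cw; have aw' := continuous_adm b cw'.
have E0 t : t <= T -> t <= 0 -> w t = w' t.
  by move=> tT t0; rewrite wP// w'P//; exact: Psi_base.
move=> t tT; have [t0|t0] := leP t 0; first exact: E0.
have T0 : 0 <= T := le_trans (ltW t0) tT.
apply: (@real_induction _ (fun t => w t = w' t) 0 T); rewrite ?(ltW t0)//.
- exact: E0.
- move=> {t t0 tT} t /andP[t0 tT] wt.
  have {}wt s : s <= t -> w s = w' s.
    move=> st; have [s0|s0] := leP 0 s; first by apply: wt; rewrite s0.
    by apply: E0; [exact: le_trans st (ltW tT)|exact: ltW].
  have [h0 h00 ctr] := Psi_contraction aw t0.
  have [d d0 wd] := (continuous_atP _ _).1 (cw t) 1 ltr01.
  have [d' d'0 w'd] := (continuous_atP _ _).1 (cw' t) 1 ltr01.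
  pose h := Num.min (Num.min h0 (T - t)) (Num.min d d').
  have h_gt0 : 0 < h by rewrite !lt_min h00 subr_gt0 tT d0.
  have [hh0 hT hd hd'] : [/\ h <= h0, h <= T - t, h <= d & h <= d'].
    by split; rewrite !ge_min lexx ?orbT.
  have near_t s : t <= s < t + h -> `|s - t| < h.
    by move=> /andP[ts sh]; rewrite ger0_norm ?subr_ge0// ltrBlDl.
  have Pt : Psi w t = w t by rewrite -wP// ltW.
  (* Both functions stay within 1 of [w t], which gives the initial bound 2; each use of the
     fixed-point equation halves it. *)
  have diff n s : t <= s < t + h -> `|w s - w' s| <= 2 / 2 ^+ n.
    elim: n s => [|n IH] s tsh.
      rewrite expr0 divr1 -(subrKA (w t)) (le_trans (ler_normD _ _))//.
      rewrite (_ : 2 = 1 + 1)// lerD ?wd ?(lt_le_trans (near_t _ tsh))//.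
      by rewrite distrC wt// w'd ?(lt_le_trans (near_t _ tsh)).
    have /andP[ts sh] := tsh.
    have sT : s <= T by move: sh hT; lra.
    rewrite wP// w'P// exprSr invfM mulrA.
    apply: (ctr h) => //.
    + by rewrite h_gt0.
    + by move=> q /ltW qt; rewrite wt.
    + by move=> q qth; rewrite Pt wd// (lt_le_trans (near_t _ qth)).
    + by move=> q qth; rewrite Pt wt// w'd// (lt_le_trans (near_t _ qth)).
    + by rewrite ts ltW.
  exists h => // s /andP[ts sh] _.
  apply/eqP; rewrite -subr_eq0 -normr_le0; apply: (@le0_geometric _ 2) => n.
  by apply: diff; rewrite sh (ltW ts).
- move=> {t t0 tT} t /andP[t0 tT] wt; rewrite wP// w'P//; apply: Psi_causal => // s st.
  have [s0|s0] := leP 0 s; first by apply: wt; rewrite s0.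
  by apply: E0; [exact: le_trans (ltW st) tT|exact: ltW].
Qed.

Lemma sol_upto_le T T' w : T <= T' -> sol_upto T' w -> sol_upto T w.
Proof. by move=> TT' [cw wP]; split=> // t tT; apply: wP; exact: le_trans TT'. Qed.

Lemma sol_upto_min T w : sol_upto T w -> sol_upto T (fun t => w (Num.min t T)).
Proof.
move=> [cw wP]; split; first exact: continuous_minr.
move=> t tT; rewrite min_l// wP//; apply: Psi_causal.
- exact: continuous_adm.
- by apply: continuous_adm; exact: continuous_minr.
- by move=> s st; rewrite min_l// (le_trans (ltW st)).
Qed.

(** Picard iteration on [[tau, tau + h]], started from the solution frozen at its value at [tau]. *)
Lemma sol_upto_extend tau w : 0 <= tau -> sol_upto tau w ->
  exists2 h : R, 0 < h & exists w', sol_upto (tau + h) w'.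
Proof.
move=> tau0 /sol_upto_min[cw wP].
have [v [cv vP vtau]] : exists v, [/\ continuous v,
    forall t, t <= tau -> v t = Psi v t & forall t, tau <= t -> v t = v tau].
  exists (fun t => w (Num.min t tau)); split=> // t taut.
  by rewrite minxx min_r.
have av := continuous_adm b cv.
have [h0 h00 ctr] := Psi_contraction av tau0.
have half0 : 0 < 2^-1 :> R by rewrite invr_gt0.
have cPv : continuous (Psi v) by exact: Psi_continuous.
have [d d0 Pd] := (continuous_atP _ _).1 (cPv tau) 2^-1 half0.
pose h := Num.min h0 (d / 2); have h_gt0 : 0 < h by rewrite lt_min h00 divr_gt0.
have hh0 : 0 < h <= h0 by rewrite h_gt0 ge_min lexx.
have hd : h < d.
  by rewrite gt_min; apply/orP; right; rewrite ltr_pdivrMr// mulr_natr mulr2n ltrDl.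
have c0E : Psi v tau = v tau by rewrite -vP.
pose inv u := [/\ continuous u, forall t, t <= tau -> u t = v t &
  forall t, tau <= t -> `|u t - v tau| <= 1].
(* Freezing at [tau + h] keeps the iterates continuous on the whole line and lets every estimate
   hold for all times. *)
pose step u t := Psi u (Num.min t (tau + h)).
have min_h t : tau <= t -> tau <= Num.min t (tau + h) <= tau + h.
  by move=> taut; rewrite le_min taut lerDl (ltW h_gt0) ge_min lexx orbT.
have inv_step u : inv u -> inv (step u).
  move=> [cu uv u1]; have au := continuous_adm b cu; split.
  - by apply: continuous_minr; exact: Psi_continuous.
  - move=> t ttau; rewrite /step min_l; last by rewrite (le_trans ttau)// lerDl ltW.
    rewrite vP//; apply: Psi_causal => // s st; apply: uv.
    exact: le_trans (ltW st) ttau.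
  - move=> t /min_h; rewrite /step; set s := Num.min _ _ => /andP[taus sh].
    (* The unit ball is preserved in two halves: the contraction applied to [u] and [v], which are
       within 1, and the continuity of [Psi v] at [tau], for which [h < d] was chosen. *)
    rewrite -(subrKA (Psi v s)) (le_trans (ler_normD _ _))// [leRHS](splitr 1) lerD//.
      apply: (ctr h) => //.
      + by move=> q /ltW/uv.
      + by move=> q /andP[/u1]; rewrite c0E.
      + by move=> q /andP[/vtau ->]; rewrite c0E subrr normr0.
      + by move=> q /andP[tauq _]; rewrite (vtau q)// u1.
      + by rewrite taus.
    rewrite -c0E mul1r; apply: Pd; rewrite ger0_norm ?subr_ge0//.
    by rewrite ltrBlDl (le_lt_trans sh)// ltrD2l.
pose u n := iter n step v.
have inv_u n : inv (u n).
  elim: n => [|n IH]; last exact: inv_step.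
  by split=> // t /vtau E; rewrite /u /= E subrr normr0.
have stepB x y M : inv x -> inv y ->
    (forall t, `|x t - y t| <= M) -> forall t, `|step x t - step y t| <= M / 2.
  move=> ix iy xyM t.
  have M0 : 0 <= M := le_trans (normr_ge0 _) (xyM 0).
  have [taut|ttau] := leP tau t; last first.
    have [_ xv _] := inv_step _ ix; have [_ yv _] := inv_step _ iy.
    by rewrite xv ?(ltW ttau)// yv ?(ltW ttau)// subrr normr0 divr_ge0.
  have [cx xv x1] := ix; have [cy yv y1] := iy.
  apply: (ctr h) => //; try exact: continuous_adm.
  - by move=> q /ltW/xv.
  - by move=> q /ltW/yv.
  - by move=> q /andP[/x1]; rewrite c0E.
  - by move=> q /andP[/y1]; rewrite c0E.
  - exact: min_h.
have ustep n t : `|u n.+1 t - u n t| <= 1 / 2 ^+ n.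
  elim: n t => [|n IH] t; last first.
    rewrite exprSr invfM mulrA.
    exact: (stepB _ _ _ (inv_u n.+1) (inv_u n) IH).
  have [_ uv u1] := inv_u 1%N; rewrite expr0 divr1.
  have [taut|ttau] := leP tau t; first by rewrite [u 0%N]/= (vtau t)// u1.
  by rewrite uv ?(ltW ttau)// subrr normr0.
have /choice[l lP] t := geometric_limit (ustep ^~ t).
have inv_l : inv l; first split.
- move=> t; apply/continuous_atP => e e0.
  (* The convergence is uniform in time, so continuity passes to the limit by the usual three-term
     estimate. *)
  have [n ne] : exists n, 2 / 2 ^+ n <= e / 3.
    apply: contrapT => /forallNP ne.
    have : e / 3 <= 0.
      by apply: (@le0_geometric _ 2) => n; rewrite ltW// ltNge; apply/negP.
    by rewrite leNgt divr_gt0.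
  have [cu _ _] := inv_u n.
  have [|q q0 uq] := (continuous_atP _ _).1 (cu t) (e / 3); first by rewrite divr_gt0.
  exists q => // s /uq us.
  have /le_trans/(_ ne) ls := lP s n; have /le_trans/(_ ne) lt := lP t n.
  rewrite (_ : l s - l t = (l s - u n s) + ((u n s - u n t) + (u n t - l t))); last by ring.
  rewrite [e](_ : _ = e / 3 + (e / 3 + e / 3)); last by field.
  rewrite (le_trans (ler_normD _ _))// lerD// (le_trans (ler_normD _ _))//.
  by rewrite lerD// distrC.
- move=> t ttau; apply/eqP; rewrite -subr_eq0 -normr_le0.
  apply: (@le0_geometric _ 2) => n; have [_ uv _] := inv_u n.
  by rewrite -(uv t)// lP.
- move=> t taut; rewrite -subr_le0; apply: (@le0_geometric _ 2) => n.
  have [_ _ u1] := inv_u n; rewrite lerBlDr -(subrKA (u n t)).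
  by rewrite (le_trans (ler_normD _ _))// lerD// u1.
have [cl lv l1] := inv_l.
exists h => //; exists l; split=> // t tth.
have -> : Psi l t = step l t by rewrite /step min_l.
(* The iterate [u n.+1 = step (u n)] is inserted between [l] and [step l]; both distances are at
   most [1 / 2 ^+ n]. *)
apply/eqP; rewrite -subr_eq0 -normr_le0; apply: (@le0_geometric _ 2) => n.
rewrite -(subrKA (u n.+1 t)) (le_trans (ler_normD _ _))//.
rewrite [leRHS](_ : _ = 2 / 2 ^+ n.+1 + 2 / 2 ^+ n / 2); last first.
  by rewrite exprSr invfM mulrA -splitr.
by rewrite lerD// distrC stepB// => ?; exact: lP.
Qed.

(** The last clause is maximality: a solution up to and including a finite [tmax] could be extended
    beyond it. *)
Lemma maximal_solution : exists (tmax : \bar R) (v : R -> R),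
  [/\ (0 < tmax)%E,
      forall T, (T%:E < tmax)%E -> sol_upto T (fun t => v (Num.min t T))
    & forall T, tmax = T%:E -> ~ exists w, sol_upto T w].
Proof.
pose S := [set T : R | exists w, sol_upto T w].
have S0 : S 0.
  have a0 := adm_cst b 0.
  (* Up to time 0 the operator does not depend on its argument, so its value on any function is a
     solution. *)
  exists (fun t => Psi (fun=> 0) (Num.min t 0)); split.
    by apply: continuous_minr; exact: Psi_continuous.
  by move=> t t0; rewrite min_l//; exact: Psi_base.
have Sext T : 0 <= T -> S T -> exists2 h, 0 < h & S (T + h).
  by move=> T0 [w wP]; have [h h0 hP] := sol_upto_extend T0 wP; exists h.
pose tmax := ereal_sup (EFin @` S).
have Smax T : S T -> (T%:E <= tmax)%E by move=> ST; apply: ereal_sup_ubound; exists T.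
have Slt T : (T%:E < tmax)%E -> S T.
  move=> /ereal_sup_gt[_ [T' [w wT'] <-]]; rewrite lte_fin => TT'.
  by exists w; exact: sol_upto_le (ltW TT') wT'.
have /choice[W WP] : forall T, exists w, S T -> sol_upto T w.
  move=> T; have [[w wT]|ST] := pselect (S T); first by exists w.
  by exists (fun=> 0) => /ST.
(* Diagonal gluing: [W T] is a chosen solution up to [T], and uniqueness makes the value at [t] the
   same for every solution reaching [t]. *)
exists tmax, (fun t => W t t); split.
- have [h h0 Sh] := Sext 0 (lexx 0) S0.
  by apply: lt_le_trans (Smax _ Sh); rewrite add0r lte_fin.
- move=> T /Slt[w wT].
  rewrite (_ : (fun t => _) = (fun t => w (Num.min t T))); first exact: sol_upto_min.
  apply/funext => t; set s := Num.min t T.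
  have ws : sol_upto s w by apply: sol_upto_le wT; rewrite ge_min lexx orbT.
  apply: (@sol_upto_unique s (W s) w) => //.
  by apply: WP; exists w.
- move=> T tE ST; have T0 : 0 <= T by rewrite -lee_fin -tE; exact: Smax.
  have [h h0 /Smax] := Sext T T0 ST.
  by rewrite tE lee_fin leNgt ltrDl h0.
Qed.

(* The left limit of [v] at [T] need not be known to exist: [Psi] turns the
   bounded function [v], extended by [0], into a continuous one. *)
Lemma sol_upto_bounded T (v : R -> R) :
  (forall T', T' < T -> sol_upto T' (fun t => v (Num.min t T'))) ->
  (exists B, forall t, b <= t < T -> `|v t| <= B) ->
  exists w, sol_upto T w.
Proof.
move=> vsol [B vB].
pose v1 := v \_ `]-oo, T[%classic.
have v1E t : t < T -> v1 t = v t.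
  by move=> tT; rewrite /v1 patchE mem_set//= in_itv/=.
have av : adm b v1.
  split.
    apply/(measurable_restrictT _ _).1 => //.
    apply: open_continuous_measurable_fun; first exact: interval_open.
    move=> t; rewrite inE/= in_itv/= => tT.
    pose T' := (t + T) / 2.
    have [tT' T'T] : t < T' /\ T' < T by split; rewrite /T'; lra.
    apply/continuous_atP => e e0.
    have [cv _] := vsol T' T'T.
    have [d d0 vd] := (continuous_atP _ _).1 (cv t) e e0.
    exists (Num.min d (T' - t)); first by rewrite lt_min d0 subr_gt0.
    move=> s; rewrite lt_min => /andP[/vd].
    rewrite (min_l (ltW tT')) ltr_norml => + /andP[_ st].
    by rewrite min_l//; move: st; lra.
  move=> T'; exists `|B| => t /andP[bt _]; rewrite /v1 patchE.
  case: ifPn => [|_]; last by rewrite normr0.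
  rewrite inE/= in_itv/= => tT.
  by rewrite (le_trans (vB t _)) ?ler_norm// bt.
have PE t : t < T -> Psi v1 t = v t.
  move=> tT; have [cv vP] := vsol t tT.
  have := vP t (lexx t); rewrite minxx => ->; apply: Psi_causal => //.
    exact: continuous_adm.
  by move=> s st; rewrite min_l ?(ltW st)// v1E// (lt_trans st).
exists (Psi v1); split; first exact: Psi_continuous.
move=> t tT; apply: Psi_causal => //; first by apply: continuous_adm; exact: Psi_continuous.
by move=> s st; have sT := lt_le_trans st tT; rewrite PE// v1E.
Qed.

End CausalFixpoint.

(** * The delay feedback as a causal operator *)

Section PrimExtra.
Context {R : realType}.
Implicit Types (b M h : R) (f g : R -> R).

(** However long the window [[s, t]] is, [f] and [g] differ only on its part after [tau], of length
    at most [h]. *)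
Lemma prim_tail b f g s t tau M h : adm b f -> adm b g -> b <= s <= t ->
  t <= tau + h -> 0 <= M -> 0 <= h ->
  (forall q, s <= q < t -> q < tau -> f q = g q) ->
  (forall q, s <= q < t -> tau <= q -> `|f q - g q| <= M) ->
  `|(prim b f t - prim b f s) - (prim b g t - prim b g s)| <= M * h.
Proof.
move=> af ag /andP[bs st] th M0 h0 fg fgM.
have [ttau|taut] := leP t tau.
  rewrite (@prim_ext _ b f g s t)// ?bs//.
    by rewrite subrr normr0 mulr_ge0.
  by move=> q qst; apply: fg => //; case/andP: qst => _ /lt_le_trans; apply.
have [taus|stau] := leP tau s.
  apply: (le_trans (prim_dist (M := M) af ag _ _)); rewrite ?bs//.
    by move=> q qst; apply: fgM => //; case/andP: qst => /(le_trans taus).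
  by rewrite ler_wpM2l// lerBlDl (le_trans th)// lerD2r.
have E F : prim b F t - prim b F s =
    (prim b F t - prim b F tau) + (prim b F tau - prim b F s) by rewrite addrA subrK.
rewrite (E f) (E g) (@prim_ext _ b f g s tau)// ?bs ?(ltW stau)//; last first.
  move=> q /andP[sq qtau]; apply: fg => //.
  by rewrite sq (lt_trans qtau).
rewrite opprD addrACA subrr addr0 (le_trans (prim_dist (M := M) af ag _ _))//.
- by rewrite (le_trans bs (ltW stau)) ltW.
- move=> q /andP[tq qt]; apply: fgM => //.
  by rewrite qt (le_trans (ltW stau)).
- by rewrite ler_wpM2l// lerBlDl.
Qed.

Lemma prim_MVT b f s t : continuous f -> b < s <= t ->
  exists2 q, s <= q <= t & prim b f t - prim b f s = f q * (t - s).
Proof.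
move=> cf /andP[bs st].
have dF x : x \in `]s, t[%R -> is_derive x 1 (prim b f) (f x).
  by rewrite in_itv/= => /andP[sx _]; apply: prim_is_derive => //; exact: lt_trans sx.
have [|q] := MVT_segment st dF; last by rewrite in_itv/=; exists q.
apply/continuous_in_subspaceT => x; rewrite inE/= in_itv/= => /andP[sx _].
by apply: prim_continuous; [exact: continuous_adm|exact: lt_le_trans sx].
Qed.

End PrimExtra.

Section Operator.
Context {R : realType} (eps c r theta BD : R) (D xb vb : R -> R).
Context (eps_gt0 : 0 < eps) (c_gt0 : 0 < c) (r_gt0 : 0 < r).
Context (D_cont : continuous D).
Context (D_lip : forall s t : R, 0 <= s <= t -> `|D t - D s| <= BD * (t - s)).
Context (BD_ge0 : 0 <= BD) (xb_cont : continuous xb) (vb_cont : continuous vb).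
Implicit Types (v w : R -> R) (s t : R).

(* Strictly left of [- r], so that [prim base f] is differentiable at every time
   [>= - r]. *)
Definition base : R := - r - 1.
Local Notation b := base.

(** The minimum and maximum splice past and future: for [t <= 0] only [xb t + D 0] remains, and
    [D 0] vanishes for [noise]. *)
Definition state v t := xb (Num.min t 0) + D (Num.max t 0) +
  (prim b v (Num.max t 0) - prim b v 0).
Definition control v t := v t - theta * state v t.
(** [cross] and [energy] stand for [<x_t, u_t>] and [||x_t||^2], written as differences of
    primitives so that the estimates on [prim] apply. *)
Definition cross v t :=
  prim b (fun s => state v s * control v s) t -
  prim b (fun s => state v s * control v s) (t - r).
Definition energy v t :=
  prim b (fun s => state v s ^+ 2) t - prim b (fun s => state v s ^+ 2) (t - r).
Definition gain (x0 xr w n : R) : R :=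
  (pospart (x0 ^+ 2 - xr ^+ 2 - 2 * w) + c * r * x0 ^+ 2)
  / (2 * (n + pospart (eps ^+ 2 - x0 ^+ 2))).
Definition feedback v t :=
  - (2 * c + gain (state v t) (state v (t - r)) (cross v t) (energy v t)) * state v t.
Definition drive v t := theta * state v t + feedback v t.
(* Subtracting [drive v 0] makes [Psi v] continuous for every [v]; for solutions
   it cancels against [vb 0], by the compatibility condition defining [X]. *)
Definition Psi v t := vb (Num.min t 0) + drive v (Num.max t 0) - drive v 0.

Lemma base_lt0 : b < 0. Proof. move: r_gt0; rewrite /base; lra. Qed.
Lemma base_ltr t : 0 <= t -> b < t - r. Proof. move: r_gt0; rewrite /base; lra. Qed.

Lemma continuous_max0_comp (f : R -> R) : (forall t : R, 0 <= t -> {for t, continuous f}) ->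
  continuous (fun t : R => f (Num.max t 0) : R).
Proof.
move=> cf t; apply: (@continuous_at_comp _ (Num.max^~ 0) f); first exact: continuous_maxr.
by apply: cf; rewrite le_max lexx orbT.
Qed.

Lemma state_continuous v : adm b v -> continuous (state v).
Proof.
move=> av t; apply: cvgD; last apply: cvgB; last exact: cvg_cst.
  apply: cvgD; first exact: continuous_minr.
  by apply: continuous_max0_comp => s _; exact: D_cont.
apply: continuous_max0_comp => s s0; apply: prim_continuous => //.
exact: lt_le_trans base_lt0 s0.
Qed.

Lemma state_adm v : adm b v -> adm b (state v).
Proof. by move=> /state_continuous; exact: continuous_adm. Qed.

Lemma control_adm v : adm b v -> adm b (control v).
Proof.
by move=> av; apply: admB => //; apply: admM; [exact: adm_cst|exact: state_adm].
Qed.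

Lemma cross_adm v : adm b v -> adm b (fun s => state v s * control v s).
Proof. by move=> av; apply: admM; [exact: state_adm|exact: control_adm]. Qed.

Lemma energy_continuous v : adm b v -> continuous (fun s => state v s ^+ 2).
Proof.
move=> av t; rewrite /continuous_at; apply: cvgM; exact: state_continuous.
Qed.

Lemma energy_adm v : adm b v -> adm b (fun s => state v s ^+ 2).
Proof. by move=> /energy_continuous; exact: continuous_adm. Qed.

Definition den v t := energy v t + pospart (eps ^+ 2 - state v t ^+ 2).

(** If [x(t)^2 < eps^2], the positive part is positive. Otherwise [x(t)] is nonzero, and by
    continuity [x^2] stays above half its value at [t] on a final piece of the window, so the energy
    is positive. *)
Lemma den_gt0 v t : adm b v -> 0 <= t -> 0 < den v t.
Proof.
move=> av t0.
have cx := energy_continuous av.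
have en_ge s q : b < s <= q -> prim b (fun s => state v s ^+ 2) s <=
    prim b (fun s => state v s ^+ 2) q.
  move=> bsq; have [p _ pE] := prim_MVT cx bsq.
  rewrite -subr_ge0 pE mulr_ge0 ?sqr_ge0// subr_ge0; by case/andP: bsq.
have btr := base_ltr t0.
have [xe|xe] := ltP (state v t ^+ 2) (eps ^+ 2).
  rewrite ltr_wpDl//; last by rewrite /pospart lt_max subr_gt0 xe.
  by rewrite subr_ge0 en_ge// btr/= gerBl ltW.
rewrite ltr_pwDl ?pospart_ge0//.
have x2 : 0 < state v t ^+ 2 by apply: lt_le_trans xe; rewrite exprn_gt0.
have [|d d0 xd] := (continuous_atP _ _).1 (cx t) (state v t ^+ 2 / 2).
  by rewrite divr_gt0.
pose s := Num.max (t - r) (t - d / 2).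
have st : s < t by rewrite gt_max !ltrBlDr !ltrDl r_gt0 divr_gt0.
have bs : b < s by rewrite lt_max btr.
have [|q /andP[sq qt] qE] := @prim_MVT _ b _ s t cx; first by rewrite bs ltW.
have /xd : `|q - t| < d.
  have : t - d / 2 <= q by apply: le_trans sq; rewrite le_max lexx orbT.
  by rewrite ltr_norml => ?; apply/andP; split; lra.
rewrite ler_norml => /andP[xq _].
rewrite /energy -(subrKA (prim b (fun s => state v s ^+ 2) s)) qE ltr_pwDl//.
  rewrite mulr_gt0 ?subr_gt0//; lra.
by rewrite subr_ge0 en_ge// btr/= le_max lexx.
Qed.

(** Holds even for discontinuous [v]: [control v] may jump with [v], but it enters [drive] only
    under an integral. *)
Lemma drive_continuous v t : adm b v -> 0 <= t -> {for t, continuous (drive v)}.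
Proof.
move=> av t0; have sc := state_continuous av.
have cP (f : R -> R) : adm b f -> {for t, continuous (fun t => prim b f t - prim b f (t - r))}.
  move=> af; apply: cvgB.
    by apply: prim_continuous => //; exact: lt_le_trans base_lt0 t0.
  apply: (@continuous_at_comp _ (fun t => t - r) (prim b f)).
    by apply: cvgB; [exact: cvg_id|exact: cvg_cst].
  by apply: prim_continuous => //; exact: base_ltr.
have cpp (f : R -> R) : {for t, continuous f} ->
      {for t, continuous (fun t => pospart (f t) : R)}.
  move=> cf; apply: (@continuous_at_comp _ f (@pospart R)) => //.
  exact: continuous_maxr.
have c2 (f : R -> R) : {for t, continuous f} -> {for t, continuous (fun t => f t ^+ 2 : R)}.
  by move=> cf; rewrite /prop_for /continuous_at; apply: cvgM.
have scr : {for t, continuous (fun t => state v (t - r))}.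
  apply: (@continuous_at_comp _ (fun t => t - r) (state v)); last exact: sc.
  by apply: cvgB; [exact: cvg_id|exact: cvg_cst].
apply: cvgD; first by apply: cvgM; [exact: cvg_cst|exact: sc].
apply: cvgM; last exact: sc.
apply: cvgN; apply: cvgD; first exact: cvg_cst.
apply: cvgM.
  apply: cvgD; last by apply: cvgM; [exact: cvg_cst|apply: c2; exact: sc].
  apply: cpp; apply: cvgB; last by apply: cvgM; [exact: cvg_cst|apply: cP; exact: cross_adm].
  by apply: cvgB; apply: c2; [exact: sc|exact: scr].
apply: cvgV; first by rewrite mulf_neq0// gt_eqF// -/(den v t) den_gt0.
apply: cvgM; first exact: cvg_cst.
apply: cvgD; first by apply: cP; exact: energy_adm.
apply: cpp; apply: cvgB; first exact: cvg_cst.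
apply: c2; exact: sc.
Qed.

Lemma Psi_continuous v : adm b v -> continuous (Psi v).
Proof.
move=> av t; apply: cvgB; last exact: cvg_cst.
apply: cvgD; first exact: continuous_minr.
by apply: continuous_max0_comp => s s0; exact: drive_continuous.
Qed.

Lemma state_causal v w t : adm b v -> adm b w -> (forall s, s < t -> v s = w s) ->
  state v t = state w t.
Proof.
move=> av aw vw; rewrite /state; congr (_ + _); apply: prim_ext => //.
  by rewrite (ltW base_lt0)/= le_max lexx orbT.
move=> q /andP[q0]; rewrite lt_max => /orP[/vw//|]; by rewrite ltNge q0.
Qed.

Lemma drive_causal v w t : adm b v -> adm b w -> 0 <= t ->
  (forall s, s < t -> v s = w s) -> drive v t = drive w t.
Proof.
move=> av aw t0 vw.
have sE s : s <= t -> state v s = state w s.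
  by move=> st; apply: state_causal => // q qs; apply: vw; exact: lt_le_trans st.
have bt : b <= t - r <= t by rewrite ltW ?base_ltr//= gerBl ltW.
have cE : cross v t = cross w t.
  apply: prim_ext; [exact: cross_adm|exact: cross_adm|exact: bt|].
  by move=> q /andP[_ qt]; rewrite /control sE ?(ltW qt)// vw.
have eE : energy v t = energy w t.
  apply: prim_ext; [exact: energy_adm|exact: energy_adm|exact: bt|].
  by move=> q /andP[_ qt]; rewrite sE ?(ltW qt).
have tr : t - r <= t by rewrite gerBl ltW.
by rewrite /drive /feedback cE eE (sE _ tr) (sE _ (lexx t)).
Qed.

Lemma Psi_neg v t : t <= 0 -> Psi v t = vb t.
Proof. by move=> t0; rewrite /Psi min_l// max_r// addrK. Qed.

Lemma Psi_causal v w t : adm b v -> adm b w ->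
  (forall s, s < t -> v s = w s) -> Psi v t = Psi w t.
Proof.
move=> av aw vw; have [t0|t0] := leP t 0; first by rewrite !Psi_neg.
rewrite /Psi (@drive_causal v w 0)//; last by move=> s s0; apply: vw; exact: lt_trans t0.
rewrite (@drive_causal v w (Num.max t 0))// ?le_max ?lexx ?orbT//.
by rewrite max_l ?(ltW t0).
Qed.

Lemma state_near tau h M v w t : adm b v -> adm b w -> 0 <= tau -> 0 <= h ->
  (forall s, s < tau -> v s = w s) ->
  (forall s, tau <= s < tau + h -> `|v s - w s| <= M) -> 0 <= M ->
  t <= tau + h -> `|state v t - state w t| <= M * h.
Proof.
move=> av aw tau0 h0 vw vwM M0 th.
rewrite (_ : state v t - state w t = (prim b v (Num.max t 0) - prim b v 0) -
  (prim b w (Num.max t 0) - prim b w 0)); last by rewrite /state; ring.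
have mt : Num.max t 0 <= tau + h by rewrite ge_max th addr_ge0.
apply: (@prim_tail _ b v w 0 (Num.max t 0) tau) => //.
- by rewrite (ltW base_lt0)/= le_max lexx orbT.
- by move=> q _; exact: vw.
- by move=> q /andP[_ qt] tq; rewrite vwM// tq (lt_le_trans qt).
Qed.

Lemma state_bound v T K Bx Bd : adm b v -> 0 <= T -> 0 <= K ->
  (forall s, b <= s < T -> `|v s| <= K) ->
  (forall s, b <= s <= 0 -> `|xb s| <= Bx) ->
  (forall s, 0 <= s <= T -> `|D s| <= Bd) ->
  forall t, b <= t <= T -> `|state v t| <= Bx + Bd + K * T.
Proof.
move=> av T0 K0 vK xB DB t /andP[bt tT].
rewrite /state (le_trans (ler_normD _ _))// lerD//.
  rewrite (le_trans (ler_normD _ _))// lerD//.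
    by apply: xB; rewrite le_min bt (ltW base_lt0)/= ge_min lexx orbT.
  by apply: DB; rewrite le_max lexx orbT/= ge_max tT.
have m0 : 0 <= Num.max t 0 by rewrite le_max lexx orbT.
have mT : Num.max t 0 <= T by rewrite ge_max tT.
apply: (le_trans (prim_lip (M := K) av _ _)).
- by rewrite (ltW base_lt0).
- move=> q /andP[q0 qt]; apply: vK; rewrite (le_trans (ltW base_lt0) q0)/=.
  exact: lt_le_trans mT.
- by rewrite subr0 ler_wpM2l.
Qed.

Definition admissible v tau h w := [/\ adm b w, forall s, s < tau -> w s = v s &
  forall s, tau <= s < tau + h -> `|w s - Psi v tau| <= 1].

Lemma admissible_bound v tau : adm b v -> 0 <= tau ->
  exists2 K : R, 0 <= K & forall h w, 0 < h <= 1 -> admissible v tau h w ->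
    [/\ forall s, b <= s < tau + h -> `|w s| <= K,
        forall s, b <= s <= tau + h -> `|state w s| <= K
      & forall s, b <= s < tau + h -> `|control w s| <= K].
Proof.
move=> av tau0.
have [Bv vB] := av.2 tau.
have [Bx xB] := (continuous_adm b xb_cont).2 0.
have [Bd DB] := (continuous_adm b D_cont).2 (tau + 1).
(* [K0] bounds [w], by [Bv] before [tau] and by the unit ball after it; [K1] then bounds the state
   and [K0 + |theta| * K1] the control. The final constant dominates all three. *)
pose K0 := `|Bv| + (`|Psi v tau| + 1).
have K0_ge0 : 0 <= K0 by rewrite !addr_ge0.
pose K1 := Bx + Bd + K0 * (tau + 1).
have K1_ge0 : 0 <= K1.
  have DB0 : 0 <= Bd.
    apply: le_trans (normr_ge0 (D tau)) (DB tau _).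
    apply/andP; split; first exact: le_trans (ltW base_lt0) tau0.
    by rewrite lerDl.
  have Bx0 : 0 <= Bx.
    by apply: le_trans (normr_ge0 (xb 0)) (xB 0 _); rewrite (ltW base_lt0) lexx.
  by rewrite !addr_ge0// mulr_ge0// addr_ge0.
have K2_ge0 : 0 <= K0 + `|theta| * K1 by rewrite addr_ge0// mulr_ge0.
exists (K0 + `|theta| * K1 + K1) => [|h w /andP[h0 h1] [aw wv w1]].
  exact: addr_ge0.
have wK s : b <= s < tau + h -> `|w s| <= K0.
  move=> /andP[bs sh]; have [taus|stau] := leP tau s.
    rewrite -[w s](subrK (Psi v tau)) (le_trans (ler_normD _ _))// /K0 addrC.
    by rewrite ler_wpDl// lerD2l w1// taus.
  rewrite wv// (le_trans (vB s _)) ?bs ?(ltW stau)// /K0.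
  by rewrite (le_trans (ler_norm _))// lerDl addr_ge0.
have wK1 t : b <= t <= tau + h -> `|state w t| <= K1.
  move=> bt; have th0 : 0 <= tau + h by rewrite addr_ge0// ltW.
  have DBh s : 0 <= s <= tau + h -> `|D s| <= Bd.
    move=> /andP[s0 sh]; apply: DB; rewrite (le_trans (ltW base_lt0) s0)/=.
    by rewrite (le_trans sh)// lerD2l.
  apply: (le_trans (state_bound aw th0 K0_ge0 wK xB DBh bt)).
  by rewrite lerD2l ler_wpM2l// lerD2l.
split=> s bs.
- by rewrite (le_trans (wK s bs))// -addrA lerDl addr_ge0// mulr_ge0.
- by rewrite (le_trans (wK1 s bs))// lerDr.
- rewrite (le_trans (ler_normB _ _))// ler_wpDr// lerD ?wK// normrM ler_wpM2l//.
  by apply: wK1; case/andP: bs => -> /ltW.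
Qed.

(** Positivity at [tau] is made uniform over all candidates: the denominator moves by at most a
    multiple of [h], so half of its value at [tau] survives on a short interval. *)
Lemma admissible_den v tau : adm b v -> 0 <= tau ->
  exists m h1 : R, [/\ 0 < m, 0 < h1 & forall h w, 0 < h <= h1 ->
    admissible v tau h w -> forall t, tau <= t <= tau + h -> m <= den w t].
Proof.
move=> av tau0; have [K K0 HK] := admissible_bound av tau0.
have den0 := den_gt0 av tau0.
(* The energy moves by at most [K^2 * h] at each end of the window. The state has Lipschitz constant
   [BD + K] on the step and is bounded by [K], so its square moves by at most
   [2 * K * (BD + K) * h]. *)
pose C := 2 * K ^+ 2 + 2 * K * (BD + K).
have C0 : 0 <= C.
  by apply: addr_ge0; apply: mulr_ge0; rewrite ?sqr_ge0 ?mulr_ge0 ?addr_ge0.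
exists (den v tau / 2), (Num.min 1 (den v tau / 2 / (C + 1))); split.
- by rewrite divr_gt0.
- by rewrite lt_min ltr01 divr_gt0 ?divr_gt0// ltr_wpDl.
move=> h w /andP[h0]; rewrite le_min ler_pdivlMr ?ltr_wpDl// => /andP[h1 hC] ah.
have h01 : 0 < h <= 1 by rewrite h0.
have [wK0 wK1 _] := HK h w h01 ah; have [aw wv _] := ah.
move=> t /andP[taut th].
have btau : b <= tau by rewrite (le_trans (ltW base_lt0)).
have bt : b <= t by rewrite (le_trans btau).
have t0 := le_trans tau0 taut.
have tauh : t - tau <= h by rewrite lerBlDl.
have sE : state w tau = state v tau by apply: state_causal.
have tautau : tau <= tau + h by rewrite lerDl ltW.
have dst : `|state w t - state v tau| <= (BD + K) * h.
  rewrite -sE (_ : state w t - state w tau = (D t - D tau) + (prim b w t - prim b w tau)).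
    rewrite (le_trans (ler_normD _ _))// mulrDl lerD//.
      by rewrite (le_trans (D_lip _)) ?tau0// ler_wpM2l.
    apply: (le_trans (prim_lip (M := K) aw _ _)); first by rewrite btau.
      by move=> q /andP[tq qt]; apply: wK0; rewrite (le_trans btau tq) (lt_le_trans qt).
    by rewrite ler_wpM2l.
  rewrite /state !(max_l t0) !(max_l tau0) !(min_r t0) !(min_r tau0); ring.
have eE : energy w tau = energy v tau.
  apply: prim_ext; [exact: energy_adm|exact: energy_adm| |].
    by rewrite ltW ?base_ltr//= gerBl ltW.
  move=> q /andP[_ qt]; congr (_ ^+ 2); apply: state_causal => // s sq.
  by apply: wv; exact: lt_trans qt.
have pl p q : b <= p <= q -> q <= tau + h -> q - p <= h ->
    `|prim b (fun s => state w s ^+ 2) q - prim b (fun s => state w s ^+ 2) p| <= K ^+ 2 * h.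
  move=> bpq qh qph; have aw2 := energy_adm aw.
  apply: (le_trans (prim_lip (M := K ^+ 2) aw2 bpq _)).
    move=> s /andP[ps sq]; have sK : `|state w s| <= K.
      by apply: wK1; case/andP: bpq => bp _; rewrite (le_trans bp ps) (le_trans (ltW sq)).
    by rewrite normrX lerXn2r ?nnegrE.
  by rewrite ler_wpM2l ?sqr_ge0.
have den_en : `|energy w t - energy v tau| <= 2 * K ^+ 2 * h.
  rewrite -eE /energy; move: pl; set F := prim b _ => pl.
  have -> : F t - F (t - r) - (F tau - F (tau - r)) =
    (F t - F tau) - (F (t - r) - F (tau - r)) by ring.
  have -> : 2 * K ^+ 2 * h = K ^+ 2 * h + K ^+ 2 * h by ring.
  have btr : b <= tau - r by exact: ltW (base_ltr tau0).
  have trh : t - r <= tau + h by apply: le_trans th; rewrite gerBl ltW.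
  apply: (le_trans (ler_normB _ _)); apply: lerD.
    by apply: pl th tauh; rewrite btau.
  apply: pl trh _; first by rewrite btr lerD2r.
  by rewrite opprB addrA subrK.
have x2 : `|state w t ^+ 2 - state v tau ^+ 2| <= 2 * K * (BD + K) * h.
  have tK : `|state w t| <= K by apply: wK1; rewrite bt.
  have tauK : `|state v tau| <= K by rewrite -sE; apply: wK1; rewrite btau.
  rewrite subr_sqr normrM mulrC -[leRHS]mulrA.
  apply: ler_pM; [exact: normr_ge0|exact: normr_ge0| |exact: dst].
  by apply: (le_trans (ler_normD _ _)); rewrite mulr_natl mulr2n; exact: lerD.
have pd : `|pospart (eps ^+ 2 - state w t ^+ 2) - pospart (eps ^+ 2 - state v tau ^+ 2)|
    <= 2 * K * (BD + K) * h.
  apply: le_trans (pospart_dist _ _) _.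
  rewrite (_ : _ - _ = state v tau ^+ 2 - state w t ^+ 2); last by ring.
  by rewrite distrC.
have hC' : 2 * K ^+ 2 * h + 2 * K * (BD + K) * h <= den v tau / 2.
  rewrite -mulrDl mulrC; apply: le_trans hC; apply: ler_wpM2l; first exact: ltW.
  by rewrite lerDl.
move: den_en pd; rewrite !ler_norml => /andP[e1 _] /andP[e2 _].
exact: half_le_lin hC' e1 e2.
Qed.

Lemma gain_lipschitz (m K Kz Kn Cz Cn : R) : 0 < m ->
  exists2 C : R, 0 <= C & forall e x x' y y' z z' n n', 0 <= e ->
    near2 K 1 e x x' -> near2 K 1 e y y' ->
    near2 Kz Cz e z z' -> near2 Kn Cn e n n' ->
    m <= n + pospart (eps ^+ 2 - x ^+ 2) -> m <= n' + pospart (eps ^+ 2 - x' ^+ 2) ->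
    `|(theta * x + - (2 * c + gain x y z n) * x) -
      (theta * x' + - (2 * c + gain x' y' z' n') * x')| <= C * e.
Proof.
move=> m0.
suff [C HC] : exists C : R, forall e x x' y y' z z' n n', 0 <= e ->
    near2 K 1 e x x' -> near2 K 1 e y y' ->
    near2 Kz Cz e z z' -> near2 Kn Cn e n n' ->
    m <= n + pospart (eps ^+ 2 - x ^+ 2) -> m <= n' + pospart (eps ^+ 2 - x' ^+ 2) ->
    near2 (`|theta| * K +
        (`|2 * c| + (K * K + K * K + `|2| * Kz + `|c * r| * (K * K)) * (2 * m)^-1) * K)
      C e (theta * x + - (2 * c + gain x y z n) * x)
      (theta * x' + - (2 * c + gain x' y' z' n') * x').
  exists `|C| => // e x x' y y' z z' n n' e0 h1 h2 h3 h4 h5 h6.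
  have [_ _ H] := HC _ _ _ _ _ _ _ _ _ e0 h1 h2 h3 h4 h5 h6.
  by apply: le_trans H _; rewrite ler_wpM2r// ler_norm.
(* The constant is left to unification: the closure rules of [near2] assemble it along the formula
   for [gain]. *)
eexists => e x x' y y' z z' n n' e0 nx ny nz nn mn mn'.
apply: near2D; first exact: (near2M (near2_cst e theta) nx).
apply: (near2M _ nx); apply: near2N; apply: near2D; first exact: near2_cst.
have nxx := near2M nx nx; have nyy := near2M ny ny.
rewrite /gain !expr2; apply: near2M.
  apply: near2D; last exact: (near2M (near2_cst e (c * r)) nxx).
  apply: near2_pospart; apply: near2D; last exact: (near2N (near2M (near2_cst e 2) nz)).
  exact: (near2D nxx (near2N nyy)).
have pm : 0 < 2 * m by rewrite mulr_gt0.
apply: near2V => //.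
- by rewrite ler_wpM2l// -!expr2.
- by rewrite ler_wpM2l// -!expr2.
apply: (near2M (near2_cst e 2)); apply: (near2D nn).
exact: (near2_pospart (near2D (near2_cst e (eps * eps)) (near2N nxx))).
Qed.

(** Every argument of [gain] is a state or an integral and changes by [O(M h)], so a small [h]
    absorbs the Lipschitz constant of [gain_lipschitz]. *)
Lemma Psi_contraction v tau : adm b v -> 0 <= tau ->
  exists2 h0 : R, 0 < h0 & forall h w w', 0 < h <= h0 -> adm b w -> adm b w' ->
    (forall s, s < tau -> w s = v s) -> (forall s, s < tau -> w' s = v s) ->
    (forall s, tau <= s < tau + h -> `|w s - Psi v tau| <= 1) ->
    (forall s, tau <= s < tau + h -> `|w' s - Psi v tau| <= 1) ->
    forall M, (forall s, tau <= s < tau + h -> `|w s - w' s| <= M) ->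
    forall t, tau <= t <= tau + h -> `|Psi w t - Psi w' t| <= M / 2.
Proof.
move=> av tau0; have [K K0 HK] := admissible_bound av tau0.
have [m [h1 [m0 h10 Hm]]] := admissible_den av tau0.
(* [Cz] and [Cn] are the constants that [near2M] yields for the integrands [x * u] and [x * x]. *)
pose Cz := K * (1 + `|theta|) + K * 1.
have Cz0 : 0 <= Cz by rewrite /Cz addr_ge0 ?mulr_ge0 ?addr_ge0.
pose Cn := K * 1 + K * 1.
have Cn0 : 0 <= Cn by rewrite /Cn addr_ge0 ?mulr_ge0.
have [C C0 HC] := @gain_lipschitz m K (K * K * r) (K * K * r) Cz Cn m0.
exists (Num.min (Num.min 1 h1) (2^-1 / (C + 1))).
  by rewrite !lt_min ltr01 h10 divr_gt0 ?invr_gt0// ltr_wpDl.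
move=> h w w' /andP[h0]; rewrite !le_min ler_pdivlMr ?ltr_wpDl// => /andP[/andP[h_1 hh1] hC].
move=> aw aw' wv w'v w1 w'1 M wM t /andP[taut th].
have ah : admissible v tau h w by [].
have ah' : admissible v tau h w' by [].
have h01 : 0 < h <= 1 by rewrite h0.
have h011 : 0 < h <= h1 by rewrite h0.
have [_ xK uK] := HK h w h01 ah; have [_ xK' uK'] := HK h w' h01 ah'.
have M0 : 0 <= M by apply: le_trans (wM tau _); rewrite ?lexx ?ltrDl.
have Mh0 : 0 <= M * h by rewrite mulr_ge0// ltW.
have ww' s : s < tau -> w s = w' s by move=> stau; rewrite wv// w'v.
have t0 := le_trans tau0 taut.
have btr := ltW (base_ltr t0); have bt := le_trans (ltW base_lt0) t0.
have tr : t - r <= t by rewrite gerBl ltW.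
have xE s : s <= tau -> state w s = state w' s.
  by move=> st; apply: state_causal => // q qs; apply: ww'; exact: lt_le_trans st.
have xd s : s <= tau + h -> `|state w s - state w' s| <= M * h.
  by move=> sh; apply: state_near sh => //; exact: ltW.
have nx s : b <= s <= tau + h -> near2 K 1 (M * h) (state w s) (state w' s).
  move=> bs; split; [exact: xK|exact: xK'|rewrite mul1r; apply: xd].
  by case/andP: bs.
(* The control differs by [O(M)] only, so inside the integrals the state difference is weakened to
   the same scale; integration restores the factor [h]. *)
have MhM : M * h <= M by rewrite ler_piMr.
have nxM s : b <= s < tau + h -> near2 K 1 M (state w s) (state w' s).
  move=> /andP[bs /ltW sh]; have [|? ? d] := nx s; first by rewrite bs.
  by split=> //; apply: le_trans d _; rewrite !mul1r.
have nuM s : b <= s < tau + h -> tau <= s ->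
    near2 K (1 + `|theta|) M (control w s) (control w' s).
  move=> bs taus; split; [exact: uK|exact: uK'|].
  rewrite (_ : control w s - control w' s =
    (w s - w' s) - theta * (state w s - state w' s)); last by rewrite /control; ring.
  rewrite (le_trans (ler_normB _ _))// mulrDl mul1r; apply: lerD.
    by apply: wM; rewrite taus; case/andP: bs.
  rewrite normrM; apply: ler_wpM2l => //.
  by apply: le_trans MhM; apply: xd; case/andP: bs => _ /ltW.
have prim_bound f : adm b f -> (forall s, b <= s < tau + h -> `|f s| <= K * K) ->
    `|prim b f t - prim b f (t - r)| <= K * K * r.
  move=> af fK; apply: (le_trans (prim_lip (M := K * K) af _ _)); first by rewrite btr.
    move=> q /andP[rq qt]; apply: fK; rewrite (le_trans btr rq)/=.
    exact: lt_le_trans th.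
  by rewrite opprB addrCA subrr addr0.
have xuK f g s : `|f s| <= K -> `|g s| <= K -> `|f s * g s| <= K * K :> R.
  by move=> fK gK; rewrite normrM ler_pM.
have tail f f' Cf : 0 <= Cf -> adm b f -> adm b f' ->
    (forall s, b <= s < tau + h -> s < tau -> f s = f' s) ->
    (forall s, b <= s < tau + h -> tau <= s -> `|f s - f' s| <= Cf * M) ->
    `|(prim b f t - prim b f (t - r)) - (prim b f' t - prim b f' (t - r))| <= Cf * (M * h).
  move=> Cf0 af af' fE fM; rewrite mulrA.
  apply: (@prim_tail _ b f f' (t - r) t tau (Cf * M) h) => //.
  - by rewrite btr.
  - exact: mulr_ge0.
  - exact: ltW.
  - move=> q /andP[rq qt]; apply: fE; rewrite (le_trans btr rq)/=.
    exact: lt_le_trans th.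
  - move=> q /andP[rq qt]; apply: fM; rewrite (le_trans btr rq)/=.
    exact: lt_le_trans th.
have nz : near2 (K * K * r) Cz (M * h) (cross w t) (cross w' t).
  split.
  - by apply: prim_bound; [exact: cross_adm|move=> s bs; apply: xuK;
      [apply: xK; case/andP: bs => -> /ltW|exact: uK]].
  - by apply: prim_bound; [exact: cross_adm|move=> s bs; apply: xuK;
      [apply: xK'; case/andP: bs => -> /ltW|exact: uK']].
  apply: tail Cz0 (cross_adm aw) (cross_adm aw') _ _.
    by move=> s _ st; rewrite /control (xE _ (ltW st)) ww'.
  by move=> s bs st; have [] := near2M (nxM _ bs) (nuM _ bs st).
have nn : near2 (K * K * r) Cn (M * h) (energy w t) (energy w' t).
  split.
  - by apply: prim_bound; [exact: energy_adm|move=> s bs; rewrite expr2;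
      apply: xuK; apply: xK; case/andP: bs => -> /ltW].
  - by apply: prim_bound; [exact: energy_adm|move=> s bs; rewrite expr2;
      apply: xuK; apply: xK'; case/andP: bs => -> /ltW].
  apply: tail Cn0 (energy_adm aw) (energy_adm aw') _ _.
    by move=> s _ st; rewrite (xE _ (ltW st)).
  by move=> s bs st; rewrite !expr2; have [] := near2M (nxM _ bs) (nxM _ bs).
have nxt : near2 K 1 (M * h) (state w t) (state w' t) by apply: nx; rewrite bt.
have nxr : near2 K 1 (M * h) (state w (t - r)) (state w' (t - r)).
  by apply: nx; rewrite btr; exact: le_trans th.
have dm : m <= den w t by apply: (Hm h) => //; rewrite taut.
have dm' : m <= den w' t by apply: (Hm h) => //; rewrite taut.
have dd := HC _ _ _ _ _ _ _ _ _ Mh0 nxt nxr nz nn dm dm'.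
have d0 : drive w 0 = drive w' 0.
  by apply: drive_causal => // s s0; apply: ww'; exact: lt_le_trans tau0.
rewrite (_ : Psi w t - Psi w' t = drive w t - drive w' t); last first.
  by rewrite /Psi (max_l t0) d0; ring.
apply: le_trans dd _; rewrite mulrCA; apply: ler_wpM2l => //.
by apply: le_trans hC; rewrite mulrC; apply: ler_wpM2l; [exact: ltW|rewrite lerDl].
Qed.

End Operator.

(** * Solutions of the closed loop *)

Section Solutions.
Context {R : realType} (eps c r theta B : R) (x0 u0 d g : R -> R).
Local Notation mu := (@lebesgue_measure R).
Context (eps_gt0 : 0 < eps) (c_gt0 : 0 < c) (r_gt0 : 0 < r).
Context (g_meas : measurable_fun setT g) (gB : forall t, `|g t| <= B).
Context (dg : {ae mu, forall t, `[0, +oo[%classic t -> d t = g t}).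
Context (x0_W1 : W1infty (- r) 0 x0) (u0_cont : {within `[- r, 0], continuous u0}).
Context (u0_feedback : u0 0 = - (p eps c r x0 u0 + 2 * c) * x0 0).
Implicit Types (v w x u y z : R -> R) (s t T : R).

Definition past f t : R := f (Num.max (Num.min t 0) (- r)).
(** The primitive starts at [base r] and not at 0 because [prim] is known to be continuous only to
    the right of its starting point. *)
Definition noise t : R := prim (base r) g (Num.max t 0) - prim (base r) g 0.
Definition vpast t : R := theta * past x0 t + past u0 t.

Local Notation b := (base r).
Local Notation state := (state r noise (past x0)).
Local Notation control := (control r theta noise (past x0)).
Local Notation cross := (cross r theta noise (past x0)).
Local Notation energy := (energy r noise (past x0)).
Local Notation den := (den eps r noise (past x0)).
Local Notation gain := (gain eps c r).
Local Notation feedback := (feedback eps c r theta noise (past x0)).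
Local Notation drive := (drive eps c r theta noise (past x0)).
Local Notation Psi := (Psi eps c r theta noise (past x0) vpast).
Local Notation sol_upto := (sol_upto Psi).

Lemma g_adm : adm b g. Proof. by split=> // T; exists B => t _. Qed.

Lemma B_ge0 : 0 <= B. Proof. exact: le_trans (gB 0). Qed.

Lemma Nr_le0 : - r <= 0. Proof. by rewrite oppr_le0 ltW. Qed.

Lemma noise_continuous : continuous noise.
Proof.
move=> t; apply: cvgB; last exact: cvg_cst.
apply: (@continuous_max0_comp _ (prim b g)) => s s0.
by apply: prim_continuous; [exact: g_adm|exact: lt_le_trans (base_lt0 r_gt0) s0].
Qed.

Lemma noise_lip s t : 0 <= s <= t -> `|noise t - noise s| <= B * (t - s).
Proof.
move=> /andP[s0 st]; rewrite /noise !max_l ?(le_trans s0)// opprB addrA subrK.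
apply: prim_lip => //; first exact: g_adm.
by rewrite (le_trans (ltW (base_lt0 r_gt0)) s0).
Qed.

Lemma noise0 : noise 0 = 0. Proof. by rewrite /noise maxxx subrr. Qed.

Lemma x0_cont : {within `[- r, 0], continuous x0}. Proof. by case: x0_W1. Qed.

Lemma past_continuous f : {within `[- r, 0], continuous f} -> continuous (past f).
Proof. by move=> cf; apply: clamp_continuous => //; exact: Nr_le0. Qed.

Lemma past_id f s : - r <= s <= 0 -> past f s = f s.
Proof. by move=> /andP[rs s0]; rewrite /past min_l// max_l. Qed.

Lemma vpast_continuous : continuous vpast.
Proof.
move=> t; apply: cvgD; last exact: past_continuous.
by apply: cvgM; [exact: cvg_cst|exact: past_continuous x0_cont _].
Qed.

Lemma state_continuous' v : adm b v -> continuous (state v).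
Proof.
exact: state_continuous r_gt0 noise_continuous (past_continuous x0_cont) _.
Qed.

Lemma control_continuous v : continuous v -> continuous (control v).
Proof.
move=> cv t; apply: cvgB; first exact: cv.
apply: cvgM; [exact: cvg_cst|exact: state_continuous' (continuous_adm b cv) t].
Qed.

Lemma state_past v s : - r <= s <= 0 -> state v s = x0 s.
Proof.
move=> /andP[rs s0]; rewrite /state min_l// max_r// noise0 subrr !addr0.
by rewrite past_id// rs.
Qed.

Lemma state_pos v s : 0 <= s ->
  state v s = x0 0 + (prim b g s - prim b g 0) + (prim b v s - prim b v 0).
Proof.
move=> s0; rewrite /state min_r// max_l// /noise max_l//.
by rewrite past_id// lexx Nr_le0.
Qed.

Lemma state_ext v w t : (forall s, s <= Num.max t 0 -> v s = w s) ->
  state v t = state w t.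
Proof.
move=> vw; have E s : s <= Num.max t 0 -> prim b v s = prim b w s.
  move=> st; apply: eq_Rintegral => q; rewrite inE/= in_itv/= => /andP[_ qs].
  exact: vw (le_trans qs st).
by rewrite /state !E// le_max lexx orbT.
Qed.

(** Bridge between [p] on histories and [gain]. Agreement is asked on the window only, which suits
    the initial data, an arbitrary solution and the constructed one alike. *)
Lemma p_history v x u t : continuous v -> 0 <= t ->
  (forall s, t - r <= s <= t -> x s = state v s) ->
  (forall s, t - r <= s <= t -> u s = control v s) ->
  p eps c r (history x t) (history u t) =
  gain (state v t) (state v (t - r)) (cross v t) (energy v t).
Proof.
move=> cv t0 xE uE; have av := continuous_adm b cv.
have btr := base_ltr r_gt0 t0.
have cx := state_continuous' av; have cu := control_continuous cv.
have tI s : s \in (`[- r, 0]%classic : set R) -> t - r <= t + s <= t.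
  by rewrite inE/= in_itv/= lerD2l gerDl.
have EI : inner r (history x t) (history u t) = cross v t.
  rewrite /inner /cross -(@shifted_integral R b r t) //; last first.
    by move=> s; apply: cvgM; [exact: cx|exact: cu].
  by apply: eq_Rintegral => s /tI tst; rewrite /history xE// uE.
have EN : norm2 r (history x t) ^+ 2 = energy v t.
  rewrite /norm2 sqr_sqrtr; last by apply: Rintegral_ge0 => s _; exact: sqr_ge0.
  rewrite /energy -(@shifted_integral R b r t) //; last first.
    by move=> s; rewrite /continuous_at; apply: cvgM; exact: cx.
  by apply: eq_Rintegral => s /tI tst; rewrite /history xE.
rewrite /p EI EN /history addr0 !xE//.
- by rewrite lexx gerBl ltW.
- by rewrite gerBl lexx ltW.
Qed.

Lemma drive0 v : continuous v -> (forall t, t <= 0 -> v t = vpast t) ->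
  drive v 0 = vpast 0.
Proof.
move=> cv vE.
have rE s : 0 - r <= s <= 0 -> - r <= s <= 0 by rewrite sub0r.
rewrite /drive /feedback -(@p_history v x0 u0)//.
- rewrite state_past ?Nr_le0 ?lexx// /vpast !past_id ?Nr_le0 ?lexx//.
  rewrite u0_feedback (addrC (2 * c)) /history.
  by under [in LHS]eq_fun do rewrite add0r; under [X in p _ _ _ _ X]eq_fun do rewrite add0r.
- by move=> s /rE rs; rewrite state_past.
- move=> s /rE rs; rewrite /control vE; last by case/andP: rs.
  by rewrite state_past// /vpast !past_id// addrAC subrr add0r.
Qed.

Lemma sol_past T w t : sol_upto T w -> t <= T -> t <= 0 -> w t = vpast t.
Proof. by move=> [_ wP] tT t0; rewrite wP// Psi_neg. Qed.

Lemma Psi_pos w t : continuous w -> (forall s, s <= 0 -> w s = vpast s) ->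
  0 <= t -> Psi w t = drive w t.
Proof.
by move=> cw wE t0; rewrite /Psi min_r// max_l// drive0// addrAC subrr add0r.
Qed.

Lemma sol_feedback T w t : sol_upto T w -> 0 <= t <= T -> control w t = feedback w t.
Proof.
move=> wsol /andP[t0 tT]; have [cw wP] := wsol.
rewrite /control wP// Psi_pos//; first by rewrite /drive addrAC subrr add0r.
by move=> s s0; apply: (sol_past wsol _ s0); rewrite (le_trans s0)// (le_trans t0).
Qed.

Lemma control_past T w s : sol_upto T w -> 0 <= T -> - r <= s <= 0 -> control w s = u0 s.
Proof.
move=> wsol T0 /andP[rs s0]; rewrite /control (sol_past wsol _ s0) ?(le_trans s0)//.
by rewrite state_past ?rs// /vpast !past_id ?rs// addrAC subrr add0r.
Qed.

(* The exceptional null set must not depend on [w]. *)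
Lemma state_derive : {ae mu, forall t, 0 < t ->
  forall w, continuous w -> is_derive t 1 (state w) (w t + d t)}.
Proof.
have gD := @prim_ae_derive R b g g_meas (ex_intro _ B gB).
apply: (ae_sub2 _ gD dg) => t gt dt t0 w cw.
have bt : b < t := lt_trans (base_lt0 r_gt0) t0.
have -> : d t = g t by apply: dt; rewrite /= in_itv/= ltW.
apply: (@is_derive_near_eq _ (fun s => x0 0 + (prim b g s - prim b g 0) +
  (prim b w s - prim b w 0)) _ _ _ t t0).
  move=> s; rewrite ltr_norml => /andP[ts _]; rewrite state_pos//.
  by move: ts; rewrite ltrBrDl subrr => /ltW.
have h1 := gt bt; have h2 := prim_is_derive cw bt.
have h3 := is_deriveD (is_deriveD (is_derive_cst (x0 0) t 1)
  (is_deriveB h1 (is_derive_cst (prim b g 0) t 1)))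
  (is_deriveB h2 (is_derive_cst (prim b w 0) t 1)).
by apply: is_derive_eq; rewrite add0r !subr0 addrC.
Qed.

Lemma state_W1infty T w : 0 < T -> continuous w -> W1infty (- r) T (state w).
Proof.
move=> T0 cw; have aw := continuous_adm b cw; have cx := state_continuous' aw.
have rT : - r <= T by rewrite (le_trans Nr_le0)// ltW.
have [_ ac _ Ld] := x0_W1.
split.
- exact: continuous_subspaceT.
(* The three summands are the initial arc, absolutely continuous by hypothesis and frozen after 0,
   the noise and the primitive of [w], both Lipschitz. *)
- apply: abs_contD; first apply: abs_contD.
  + apply: (@abs_cont_min0 R (- r)) => //.
    * by rewrite oppr_lt0.
    * exact: past_continuous x0_cont.
    * move=> e /ac[q q0 acq]; exists q => // n p1 p2 p12 tp12 /(acq _ _ _ p12 tp12).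
      congr (_ < _); apply: eq_bigr => i _; have [/= + + _] := p12 i.
      rewrite !in_itv/= => /andP[p1r /ltW p10] /andP[p2r /ltW p20].
      by rewrite !past_id ?(ltW p1r) ?(ltW p2r).
    * by move=> s /=; rewrite in_itv/= => /andP[].
  + apply: (@lipschitz_abs_cont _ _ _ B B_ge0) => s t _ _ /max0_lip[mst md].
    by rewrite (le_trans (noise_lip mst))// ler_wpM2l// B_ge0.
  + have [K wK] := aw.2 T.
    apply: (@lipschitz_abs_cont _ _ _ `|K|) => // s t _.
    rewrite /= in_itv/= => /andP[_ tT] /max0_lip[/andP[s0 mst] md].
    rewrite opprB addrA subrK (le_trans (prim_lip (M := `|K|) aw _ _)) ?ler_wpM2l//.
      by rewrite (le_trans (ltW (base_lt0 r_gt0)) s0).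
    move=> q /andP[sq qt]; apply: le_trans (ler_norm K); apply: wK.
    rewrite (le_trans (ltW (base_lt0 r_gt0)) (le_trans s0 sq))/= (le_trans (ltW qt))//.
    by rewrite ge_max !ltW.
- have [K xK] := within_bounded (continuous_subspaceT cx :
    {within `[- r, T], continuous state w}).
  apply/LinftyP; exists (fun s => state w (Num.max (Num.min s T) (- r))), K; split.
  + apply: continuous_measurable_fun.
    by apply: clamp_continuous => //; exact: continuous_subspaceT.
  + move=> s; apply: xK.
    by rewrite le_max lexx orbT ge_max rT ge_min lexx orbT.
  + apply: aeW => s /=; rewrite in_itv/= => /andP[/ltW rs /ltW sT].
    by rewrite min_l// max_l.
- have [g1 [B1 [mg1 g1B dg1]]] := (LinftyP _ _).1 Ld.
  have [K wK] := aw.2 T.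
  pose wT s := w (Num.max (Num.min s T) 0).
  have cwT : continuous wT.
    apply: (@clamp_continuous R w 0 T); first exact: ltW.
    exact: continuous_subspaceT.
  (* The derivative is that of [x0] before 0 and [w + d] after it; clamping [w] to [[0, T]] makes
     the representative bounded on the whole line. *)
  apply/LinftyP; exists (fun s => if s < 0 then g1 s else wT s + g s),
    (Num.max B1 (K + B)); split.
  + apply: measurable_fun_ifT => //.
      by apply: measurable_fun_ltr => //; exact: measurable_cst.
    by apply: measurable_funD => //; exact: continuous_measurable_fun.
  + move=> s; rewrite le_max; case: ifPn => _; first by rewrite g1B.
    apply/orP; right; rewrite (le_trans (ler_normD _ _))// lerD// wK//.
    by rewrite le_max (ltW (base_lt0 r_gt0)) orbT/= ge_max ge_min lexx orbT ltW.
  + have ne0 : {ae mu, forall t, t != 0}.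
      exists [set 0]; split=> //; first exact: lebesgue_measure_set1.
      by move=> s /= /negP; rewrite negbK => /eqP.
    apply: (ae_sub2 _ (ae_sub2 (fun _ => @conj _ _) state_derive dg)
      (ae_sub2 (fun _ => @conj _ _) dg1 ne0)).
    move=> t [xt dt] [d1 t0]; rewrite /= in_itv/= => /andP[rt tT].
    case: ltP => [tn|tp].
      rewrite -d1; last by rewrite /= in_itv/= rt.
      apply: (@derive1_near_eq _ _ _ _ (Num.min (- t) (t + r))).
        by rewrite lt_min oppr_gt0 tn -ltrBlDr sub0r.
      move=> s; rewrite lt_min !ltr_norml => /andP[/andP[_ s1] /andP[s2 _]].
      by rewrite state_past//; apply/andP; split; move: s1 s2; lra.
    have {}tp : 0 < t by rewrite lt_neqAle eq_sym t0.
    have [_ xdt] := xt tp w cw.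
    rewrite derive1E xdt dt; last by rewrite /= in_itv/= ltW.
    by rewrite /wT min_l ?(ltW tT)// max_l// ltW.
Qed.

(** Converse of the construction: uniqueness for the closed loop is thereby reduced to uniqueness
    for the fixed-point equation. *)
Lemma solution_sol_upto tmax y z T :
  is_solution eps c r theta d x0 u0 tmax y z -> 0 <= T -> (T%:E < tmax)%E ->
  exists2 w, sol_upto T w &
    forall s, - r <= s <= T -> y s = state w s /\ z s = control w s.
Proof.
move=> [cy cz yW yx0 zu0 yode yfb] T0 Tmax.
have rT : - r <= T := le_trans Nr_le0 T0.
have sub : `[- r, T]%classic `<=` upto (- r) tmax.
  move=> s /=; rewrite in_itv/= => /andP[rs sT]; split=> //.
  by apply: le_lt_trans Tmax; rewrite lee_fin.
pose cl s := Num.max (Num.min s T) (- r).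
pose w s := theta * y (cl s) + z (cl s).
have clE s : - r <= s <= T -> cl s = s.
  by move=> /andP[rs sT]; rewrite /cl min_l// max_l.
have cw : continuous w.
  move=> s; apply: cvgD; first apply: cvgM; first exact: cvg_cst.
    by apply: (@clamp_continuous R y) => //; exact: continuous_subspaceW cy.
  by apply: (@clamp_continuous R z) => //; exact: continuous_subspaceW cz.
have aw := continuous_adm b cw.
have wpast s : s <= 0 -> w s = vpast s.
  move=> s0; have -> : w s = theta * x0 (cl s) + u0 (cl s).
    rewrite /w yx0 ?zu0//; rewrite /cl (min_l (le_trans s0 T0));
    by rewrite le_max lexx orbT ge_max s0 Nr_le0.
  by rewrite /vpast /past /cl !min_l// (le_trans s0).
have yE s : - r <= s <= T -> y s = state w s.
  move=> /andP[rs sT]; have [s0|s0] := leP s 0.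
    by rewrite state_past ?rs// yx0// rs.
  rewrite state_pos ?(ltW s0)//.
  (* Almost everywhere [y' = theta * y + z + d = w + g], so [Z] has derivative 0, and its constancy
     is the integrated form of the ODE. *)
  pose Z q := y q + (- prim b g q - prim b w q).
  have [K wK] := aw.2 T.
  suff : Z s = Z 0 by rewrite /Z (yx0 0) ?Nr_le0 ?lexx// => ZE; move: ZE; lra.
  apply: abs_cont_derive0_cst; first exact: ltW.
    apply: abs_contD.
      (* [W1infty] gives absolute continuity on an open interval; a later time [T1] brings the
         closed endpoint [s] inside it. *)
      have [T1 TT1 T1max] := ereal_between Tmax; have sT1 := le_lt_trans sT TT1.
      have [_ acy _ _] := yW T1 T1max.
      apply: abs_cont_sub acy => q /=; rewrite !in_itv/= => /andP[q0 qs].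
      by rewrite (le_lt_trans qs sT1) andbT (lt_le_trans _ q0)// oppr_lt0.
    apply: (@lipschitz_abs_cont _ _ _ (B + `|K|)) => [|q q' /=].
      by rewrite addr_ge0 ?B_ge0.
    rewrite !in_itv/= => /andP[q0 _] /andP[_ qs'] qq'.
    have bqq : b <= q <= q' by rewrite (le_trans (ltW (base_lt0 r_gt0)) q0).
    have -> : - prim b g q' - prim b w q' - (- prim b g q - prim b w q) =
      - ((prim b g q' - prim b g q) + (prim b w q' - prim b w q)) by ring.
    rewrite normrN (le_trans (ler_normD _ _))// mulrDl lerD//.
      exact: prim_lip g_adm bqq _.
    apply: (prim_lip aw bqq) => q1 /andP[qq1 q1q']; apply: le_trans (ler_norm K).
    apply: wK; rewrite (le_trans _ qq1) ?(le_trans (ltW (base_lt0 r_gt0)) q0)//=.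
    by rewrite (le_trans (ltW q1q'))// (le_trans qs').
  have gD := @prim_ae_derive R b g g_meas (ex_intro _ B gB).
  apply: (ae_sub2 _ (ae_sub2 (fun _ => @conj _ _) gD dg) yode).
  move=> q [gq dq] yq /andP[q0 qs].
  have bq : b < q := lt_le_trans (base_lt0 r_gt0) q0.
  have uq : upto 0 tmax q.
    by split=> //; apply: le_lt_trans Tmax; rewrite lee_fin (le_trans qs).
  have qT : - r <= q <= T by rewrite (le_trans Nr_le0 q0) (le_trans qs).
  have h1 := gq bq; have h2 := prim_is_derive cw bq; have h3 := yq uq.
  have h4 := is_deriveD h3 (is_deriveB (is_deriveN h1) h2).
  apply: is_derive_eq.
  by rewrite /w clE// dq ?in_itv//=; [ring|rewrite in_itv/= q0].
have zE s : - r <= s <= T -> z s = control w s.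
  by move=> rsT; rewrite /control -yE// /w clE// addrAC subrr add0r.
exists w; last by move=> s rs; rewrite yE// zE.
split=> // t tT; have [t0|t0] := leP t 0; first by rewrite Psi_neg// wpast.
rewrite Psi_pos ?(ltW t0)// /drive /feedback -(@p_history w y z) ?(ltW t0)//.
- have rt : - r <= t <= T by rewrite tT (le_trans Nr_le0)// ltW.
  rewrite /w clE// -yE// yfb//; split; first exact: ltW.
  by apply: le_lt_trans Tmax; rewrite lee_fin.
- move=> s /andP[ts st]; apply: yE; rewrite (le_trans st tT) andbT.
  by apply: le_trans ts; rewrite lerBrDl subrr ltW.
- move=> s /andP[ts st]; apply: zE; rewrite (le_trans st tT) andbT.
  by apply: le_trans ts; rewrite lerBrDl subrr ltW.
Qed.

Lemma feedback_ge w t : continuous w -> 0 <= t -> 2 * c * `|state w t| <= `|feedback w t|.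
Proof.
move=> cw t0; have aw := continuous_adm b cw.
rewrite /feedback normrM normrN; apply: ler_wpM2r => //.
have g0 : 0 <= gain (state w t) (state w (t - r)) (cross w t) (energy w t).
  apply: divr_ge0; first by rewrite addr_ge0 ?pospart_ge0// mulr_ge0 ?sqr_ge0// mulr_ge0// ltW.
  rewrite mulr_ge0//; apply: ltW.
  exact: (den_gt0 eps_gt0 r_gt0 noise_continuous (past_continuous x0_cont) aw t0).
by rewrite ger0_norm ?lerDl// addr_ge0// mulr_ge0// ltW.
Qed.

Lemma maximal_is_solution : exists tmax : \bar R, (0 < tmax)%E /\
  exists x u : R -> R,
    [/\ is_solution eps c r theta d x0 u0 tmax x u,
        (forall y z : R -> R, is_solution eps c r theta d x0 u0 tmax y z ->
           forall t, upto (- r) tmax t -> y t = x t /\ z t = u t)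
      & (forall tm : R, tmax = tm%:E ->
           limf_esup (fun t => (`|u t|)%:E) (tm^'-) = +oo%E)].
Proof.
have cxb := past_continuous x0_cont; have cn := noise_continuous.
have Pc v : adm b v -> continuous (Psi v).
  by apply: Psi_continuous => //; exact: vpast_continuous.
have Pb v w t : t <= 0 -> Psi v t = Psi w t by move=> t0; rewrite !Psi_neg.
have Pca v w t : adm b v -> adm b w -> (forall s, s < t -> v s = w s) -> Psi v t = Psi w t.
  exact: Psi_causal.
have Pct := @Psi_contraction R eps c r theta B noise (past x0) vpast eps_gt0 r_gt0 cn
  noise_lip B_ge0 cxb.
have uniq := sol_upto_unique Pb Pca Pct.
have [tmax [v [tmax0 vsol vmax]]] := maximal_solution Pc Pb Pca Pct.
pose vT T s := v (Num.min s T).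
have xE T t : t <= T -> 0 <= T -> state v t = state (vT T) t.
  by move=> tT T0; apply: state_ext => s st; rewrite /vT min_l// (le_trans st)// ge_max tT.
have uE T t : t <= T -> 0 <= T -> control v t = control (vT T) t.
  by move=> tT T0; rewrite /control (xE T)// /vT min_l.
have between t : (t%:E < tmax)%E -> exists T, [/\ t < T, 0 < T & (T%:E < tmax)%E].
  move=> ttm; have [|T mT Ttm] := @ereal_between R (Num.max t 0) tmax.
    by case: (leP t 0).
  by exists T; move: mT; rewrite gt_max => /andP[-> ->].
have contx t : (t%:E < tmax)%E -> {for t, continuous (state v)}.
  move=> /between[T [tT T0 /vsol[cw _]]].
  apply: (@continuous_near_eq _ (state (vT T)) _ _ (T - t)); first by rewrite subr_gt0.
    move=> s; rewrite ltr_norml => /andP[_ sT]; rewrite -xE ?(ltW T0)//.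
    by move: sT; rewrite ltrD2r => /ltW.
  exact: state_continuous' (continuous_adm b cw) t.
have contu t : (t%:E < tmax)%E -> {for t, continuous (control v)}.
  move=> /between[T [tT T0 /vsol[cw _]]].
  apply: (@continuous_near_eq _ (control (vT T)) _ _ (T - t)); first by rewrite subr_gt0.
    move=> s; rewrite ltr_norml => /andP[_ sT]; rewrite -uE ?(ltW T0)//.
    by move: sT; rewrite ltrD2r => /ltW.
  exact: control_continuous cw t.
exists tmax; split=> //; exists (state v), (control v); split.
- split.
  + apply: continuous_in_subspaceT => t /set_mem[_ ttm]; exact: contx.
  + apply: continuous_in_subspaceT => t /set_mem[_ ttm]; exact: contu.
  + move=> T1 /between[T [T1T T0 /vsol wsol]].
    apply: (W1infty_sub (ltW T1T)); have [cw _] := wsol.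
    apply: (W1infty_eq _ (state_W1infty T0 cw)) => s sT.
    by rewrite -xE// ltW.
  + by move=> s rs; rewrite state_past.
  + move=> s rs; rewrite (uE 0) ?lexx//; last by case/andP: rs.
    exact: control_past (vsol 0 tmax0) (lexx 0) rs.
  (* At 0, where past and future are joined, a two-sided derivative may fail to exist; that point
     goes into the null set. *)
  + apply: (ae_sub2 _ state_derive ae_neq0) => t xt tn [t0 ttm].
    have {tn}t0' : 0 < t by rewrite lt_neqAle eq_sym tn.
    have [T [tT T0 /vsol[cw _]]] := between t ttm.
    have -> : theta * state v t + control v t = vT T t.
      by rewrite /control addrC subrK /vT min_l// ltW.
    apply: (@is_derive_near_eq _ _ _ _ _ (T - t) _ _ (xt t0' _ cw)); first by rewrite subr_gt0.
    by move=> s; rewrite ltr_norml ltrD2r => /andP[_ /ltW sT]; rewrite -xE// ltW.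
  + move=> t [t0 ttm]; rewrite (xE t) ?(uE t)//.
    rewrite (@sol_feedback t) ?t0 ?lexx//; last exact: vsol.
    have [cw _] := vsol t ttm.
    rewrite /feedback (@p_history (vT t))// => s /andP[_ st]; [exact: xE|exact: uE].
- move=> y z yz t [rt ttm]; have [T [tT T0 Ttm]] := between t ttm.
  have [w wsol wE] := solution_sol_upto yz (ltW T0) Ttm.
  have vw s : s <= T -> w s = vT T s by exact: (uniq _ _ _ wsol (vsol T Ttm) s).
  have xw : state w t = state v t.
    rewrite (xE T) ?(ltW T0) ?(ltW tT)//; apply: state_ext => s st; apply: vw.
    by rewrite (le_trans st)// ge_max !ltW.
  have [-> ->] := wE t (introT andP (conj rt (ltW tT))); split=> //.
  by rewrite /control xw vw ?(ltW tT)// /vT min_l// ltW.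
- move=> tm tmE; apply/eqP; rewrite -leye_eq leNgt; apply/negP.
  rewrite tmE lte_fin in tmax0.
  (* The limsup is an infimum of suprema, so a value below [+oo] yields a left neighbourhood of [tm]
     on which [|u|] is bounded. *)
  move=> /ereal_inf_lt[_ [V Vtm <-]] supV.
  have [M MV] : exists M : R, forall t, V t -> `|control v t| <= M.
    have ub t : V t -> ((`|control v t|)%:E <=
        ereal_sup ((fun t => (`|control v t|)%:E) @` V))%E.
      by move=> Vt; apply: ereal_sup_ubound; exists t.
    move: supV ub; case: ereal_sup => [q| |] // _ ub; last by exists 0 => t /ub.
    by exists q => t /ub; rewrite lee_fin.
  apply: (vmax tm tmE); apply: (sol_upto_bounded (v := v) Pc Pca).
    by move=> T TT; apply: vsol; rewrite tmE lte_fin.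
  move: Vtm; rewrite /at_left /within => /nbhs_ballP[h /= h0 hV].
  pose T := Num.max 0 (tm - h / 2).
  have Ttm : T < tm by rewrite gt_max tmax0 ltrBlDr ltrDl divr_gt0.
  have T0 : 0 <= T by rewrite le_max lexx.
  have [|cw _] := vsol T; first by rewrite tmE lte_fin.
  have [K wK] := (continuous_adm b cw).2 T.
  have c2 : 0 < 2 * c by rewrite mulr_gt0.
  (* Up to [T] continuity bounds [v]. Closer to [tm], [2 * c * |x| <= |u| <= M] bounds the state by
     [M / (2 * c)], hence [v = theta * x + u]. *)
  exists (Num.max K (`|theta| * (M / (2 * c)) + M)) => t /andP[bt ttm].
  rewrite le_max; have [tT|Tt] := leP t T.
    by have := wK t; rewrite bt tT min_l// => /(_ isT) ->.
  apply/orP; right.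
  have t0 : 0 <= t := le_trans T0 (ltW Tt).
  have Mt : `|control v t| <= M.
    apply: MV; apply: hV => //; apply: half_ball h0 _ ttm.
    by apply: le_lt_trans Tt; rewrite le_max lexx orbT.
  have wsol : sol_upto t (vT t) by apply: vsol; rewrite tmE lte_fin.
  have xM : `|state v t| <= M / (2 * c).
    rewrite ler_pdivlMr// mulrC (xE t)//; apply: le_trans (feedback_ge wsol.1 t0) _.
    by rewrite -(sol_feedback wsol) ?t0 ?lexx// -uE.
  have -> : v t = theta * state v t + control v t by rewrite /control addrC subrK.
  rewrite (le_trans (ler_normD _ _))// lerD// normrM.
  exact: ler_wpM2l.
Qed.

End Solutions.

Theorem theorem1 (R : realType) (eps c r : R)
    (eps_gt0 : 0 < eps) (c_gt0 : 0 < c) (r_gt0 : 0 < r)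
    (theta : R) (x0 u0 d : R -> R)
    (Hx0u0 : X eps c r x0 u0) (Hd : Linfty `[0, +oo[%classic d) :
  exists tmax : \bar R,
    (0 < tmax)%E /\
    exists x u : R -> R,
      [/\ is_solution eps c r theta d x0 u0 tmax x u,
          (forall y v : R -> R,
             is_solution eps c r theta d x0 u0 tmax y v ->
             forall t, upto (- r) tmax t -> y t = x t /\ v t = u t)
        & (forall tm : R, tmax = tm%:E ->
             limf_esup (fun t => (`|u t|)%:E) (tm^'-) = +oo%E)].
Proof.
have [x0_W1 u0_cont u0_feedback] := Hx0u0.
have [g [B [g_meas gB dg]]] := (LinftyP _ _).1 Hd.
exact: (maximal_is_solution theta eps_gt0 c_gt0 r_gt0 g_meas gB dg x0_W1 u0_cont u0_feedback).
Qed.
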